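(* Let $q$ be any power of a prime $p$ and let $U=U(q)$ be as in the context. For $j\in\{1,\dots,12\}$ write $X_j=X_{\alpha_j}$. Every $\chi\in\operatorname{Irr}(U)$ lies in exactly one of the following classes, and the classes have the stated numbers of characters and degrees: \begin{enumerate} \item $X_{12}\not\subseteq\ker\chi$: exactly $q^3(q-1)$ characters, all of degree $q^4$. \item $X_{12}\subseteq\ker\chi$, $X_{11}\not\subseteq\ker\chi$: exactly $q^4(q-1)$ characters, all of degree $q^3$. \item $X_{11}X_{12}\subseteq\ker\chi$ and $X_8,X_9,X_{10}\not\subseteq\ker\chi$: if $q$ is odd, exactly $q(q-1)^3$ characters, all of degree $q^3$; if $q$ is even, exactly $(q-1)^3$ characters of degree $q^3$ and exactly $4(q-1)^4$ characters of degree $q^3/2$, and no others. \item For each of the three choices $\{i,j,k\}=\{8,9,10\}$ with $i<j$: $X_kX_{11}X_{12}\subseteq\ker\chi$ and $X_i,X_j\not\subseteq\ker\chi$: exactly $(q-1)^3$ characters of degree $q^3$ and exactly $q^2(q-1)^2$ characters of degree $q^2$, and no others. \item For each $i\in\{8,9,10\}$: $X_j\subseteq\ker\chi$ for all $j\in\{8,9,10,11,12\}\setminus\{i\}$ and $X_i\not\subseteq\ker\chi$: exactly $(q-1)^2$ characters of degree $q^3$ and exactly $q^2(q-1)$ characters of degree $q^2$, and no others. \item $X_j\subseteq\ker\chi$ for $j=8,\dots,12$ and $X_5,X_6,X_7\not\subseteq\ker\chi$: exactly $q^2(q-1)^3$ characters, all of degree $q$. \item For each choice $\{i,j,k\}=\{5,6,7\}$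 with $i<j$: $X_j'\subseteq\ker\chi$ for $j'\in\{k,8,9,10,11,12\}$ and $X_i,X_j\not\subseteq\ker\chi$: exactly $q^2(q-1)^2$ characters, all of degree $q$. \item For each $i\in\{5,6,7\}$: $X_j\subseteq\ker\chi$ for all $j\in\{5,\dots,12\}\setminus\{i\}$ and $X_i\not\subseteq\ker\chi$: exactly $q^2(q-1)$ characters, all of degree $q$. \item $X_j\subseteq\ker\chi$ for all $j=5,\dots,12$: exactly $q^4$ characters, all linear (degree $1$). \end{enumerate}
   Context: Let $q$ be a power of a prime $p$ and $\mathbb{F}_q$ the field with $q$ elements. Let $\Phi$ be a root system of type $D_4$ with simple roots $\alpha_1,\alpha_2,\alpha_3,\alpha_4$, where $\alpha_3$ is the central node of the Dynkin diagram (so $\alpha_1,\alpha_2,\alpha_4$ are pairwise orthogonal and each is joined to $\alpha_3$). The positive roots are $\alpha_1,\dots,\alpha_4$ and $\alpha_5=\alpha_1+\alpha_3$, $\alpha_6=\alpha_2+\alpha_3$, $\alpha_7=\alpha_3+\alpha_4$, $\alpha_8=\alpha_1+\alpha_2+\alpha_3$, $\alpha_9=\alpha_1+\alpha_3+\alpha_4$, $\alpha_{10}=\alpha_2+\alpha_3+\alpha_4$, $\alpha_{11}=\alpha_1+\alpha_2+\alpha_3+\alpha_4$, $\alpha_{12}=\alpha_1+\alpha_2+2\alpha_3+\alpha_4$. Let $U=U(q)$ be the Sylow $p$-subgroup (maximal unipotent subgroup generated by positive root elements) of the Chevalley group $D_4(q)$, generated by root elements $x_i(t)=x_{\alpha_i}(t)$,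 $i=1,\dots,12$, $t\in\mathbb{F}_q$. Concretely: $x_i(t)x_i(u)=x_i(t+u)$; every element of $U$ is uniquely $x_1(d_1)x_2(d_2)\cdots x_{12}(d_{12})$ with $d_i\in\mathbb{F}_q$, so $|U|=q^{12}$; and with $[a,b]=a^{-1}b^{-1}ab$ the commutators are $[x_1(t),x_3(u)]=x_5(tu)$, $[x_1(t),x_6(u)]=x_8(-tu)$, $[x_1(t),x_7(u)]=x_9(tu)$, $[x_1(t),x_{10}(u)]=x_{11}(-tu)$, $[x_2(t),x_3(u)]=x_6(tu)$, $[x_2(t),x_5(u)]=x_8(-tu)$, $[x_2(t),x_7(u)]=x_{10}(tu)$, $[x_2(t),x_9(u)]=x_{11}(-tu)$, $[x_3(t),x_4(u)]=x_7(tu)$, $[x_3(t),x_{11}(u)]=x_{12}(-tu)$, $[x_4(t),x_5(u)]=x_9(-tu)$, $[x_4(t),x_6(u)]=x_{10}(-tu)$, $[x_4(t),x_8(u)]=x_{11}(-tu)$, $[x_5(t),x_{10}(u)]=x_{12}(-tu)$, $[x_6(t),x_9(u)]=x_{12}(-tu)$, $[x_7(t),x_8(u)]=x_{12}(tu)$, and all other $[x_i(t),x_j(u)]$ with $i<j$ equal $1$. The root subgroup is $X_{\alpha_i}=\{x_i(t):t\in\mathbb{F}_q\}\cong(\mathbb{F}_q,+)$. $\operatorname{Irr}(U)$ denotes the set of complex irreducible characters of $U$. *)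

(* Defs.v *)
From HB Require Import structures.
From mathcomp Require Import all_boot all_order all_algebra all_fingroup all_solvable all_field all_character.
Set Implicit Arguments. Unset Strict Implicit. Unset Printing Implicit Defensive.
Import GRing.Theory Num.Theory.
Local Open Scope ring_scope.

(* Commutator table of U(q) for D4: [x_i(t), x_j(u)] = x_k(+/- t u) for i < j.
   D4_comm i j = Some (k, true)  means  x_k(-tu);
   D4_comm i j = Some (k, false) means  x_k(tu);
   None means the commutator is 1. *)
Definition D4_comm (i j : nat) : option (nat * bool) :=
  match i, j with
  | 1, 3 => Some (5, false)  | 1, 6 => Some (8, true)
  | 1, 7 => Some (9, false)  | 1, 10 => Some (11, true)
  | 2, 3 => Some (6, false)  | 2, 5 => Some (8, true)
  | 2, 7 => Some (10, false) | 2, 9 => Some (11, true)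
  | 3, 4 => Some (7, false)  | 3, 11 => Some (12, true)
  | 4, 5 => Some (9, true)   | 4, 6 => Some (10, true)
  | 4, 8 => Some (11, true)  | 5, 10 => Some (12, true)
  | 6, 9 => Some (12, true)  | 7, 8 => Some (12, false)
  | _, _ => None
  end.

Definition D4_word (gT : finGroupType) (F : finFieldType) (x : nat -> F -> gT)
  (d : {ffun 'I_12 -> F}) : gT :=
  (\prod_(i < 12) x i.+1 (d i))%g.

(* G is the Sylow p-subgroup U(q) of D4(q), q = #|F|, with root elements
   x_i(t) = x i t (i = 1..12), in the sense of the context: additivity,
   unique normal form x_1(d_1)...x_12(d_12), and the commutator relations. *)
Definition D4_unipotent (gT : finGroupType) (F : finFieldType) (G : {group gT})
  (x : nat -> F -> gT) : Prop :=
  [/\ (forall i (t u : F), (0 < i <= 12)%N -> (x i t * x i u)%g = x i (t + u)%R),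
      G :=: [set D4_word x d | d : {ffun 'I_12 -> F}],
      injective (D4_word x) &
      (forall i j (t u : F), (0 < i)%N -> (i < j)%N -> (j <= 12)%N ->
         [~ x i t, x j u]%g =
         match D4_comm i j with
         | Some (k, true) => x k (- (t * u))%R
         | Some (k, false) => x k (t * u)%R
         | None => 1%g
         end)].

Definition D4rootX (gT : finGroupType) (F : finFieldType) (x : nat -> F -> gT) (j : nat)
  : {set gT} := [set x j t | t : F].

Definition D4inker (gT : finGroupType) (F : finFieldType) (G : {group gT})
  (x : nat -> F -> gT) (j : nat) (i : Iirr G) : bool :=
  D4rootX x j \subset cfker 'chi[G]_i.

Definition D4ndeg (gT : finGroupType) (G : {group gT}) (P : pred (Iirr G)) (d : nat) : nat :=
  #|[set i : Iirr G | P i && ('chi[G]_i 1%g == d%:R)]|.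

Definition D4degs_in (gT : finGroupType) (G : {group gT}) (P : pred (Iirr G)) (ds : seq nat)
  : Prop :=
  forall i : Iirr G, P i -> exists2 d, d \in ds & 'chi[G]_i 1%g = d%:R.

Definition D4setinker (gT : finGroupType) (G : {group gT}) (A : {set gT}) (i : Iirr G) : bool :=
  A \subset cfker 'chi[G]_i.

(* Main.v *)
Require Import Defs.
From HB Require Import structures.
From mathcomp Require Import all_boot all_order all_algebra all_fingroup all_solvable all_field all_character.
From mathcomp Require Import ring.
Set Implicit Arguments. Unset Strict Implicit. Unset Printing Implicit Defensive.
Import Order.TTheory GRing.Theory Num.Theory.

(** Let [B = X_3 X_5 .. X_12] and [T = X_1 X_2 X_4].  Modulo [X_12], [U] is the
semidirect product of the abelian normal subgroup [B] by the abelian group [T],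
so a character [chi] over a linear character [theta] of [B] has degree
[|T : T_theta|].  If a set [S] of irreducible characters of [U] is the set of
those lying over the members of a set [Q] of linear characters of [B], then
[sum_(chi in S) chi(1)^2 = |Q| * |U : B|]; this turns the counts into counts of
coefficient vectors [(b3, b5, .., b11)] of [theta] with a given stabilizer order.
When [b11 = 0], the stabilizer consists of the critical points [t = (t1, t2, t4)]
of the quadratic form [b8 t1 t2 + b9 t1 t4 + b10 t2 t4] at which its sum with the
linear form [b5 t1 + b6 t2 - b7 t4] vanishes.  The gradient of the quadratic form
has determinant [2 b8 b9 b10] up to sign, and this is where characteristic 2 differs.

If [chi] is nontrivial on [X_12], then the restriction of [chi] to the abelian
normal subgroup [A = X_8 .. X_12] contains a character trivial on
[X_8, .., X_11], obtained from any constituent by conjugation with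
[S = X_3 X_5 X_6 X_7]; its inertia group is [A T], so [chi(1) = q^4], and the
number of these characters follows from the sum of squares of the degrees. *)

(** * Characters above a linear character of a normal subgroup *)

Section NormalSubgroupCharacters.

Local Open Scope group_scope.
Local Open Scope ring_scope.

Lemma sum_square_ndeg (gT : finGroupType) (G : {group gT}) (P : pred (Iirr G)) d :
  \sum_(i | P i && ('chi_i 1%g == d%:R)) 'chi_i 1%g ^+ 2 = (D4ndeg P d * d ^ 2)%:R.
Proof.
rewrite natrM /D4ndeg -sum1_card natr_sum mulr_suml.
apply: eq_big => i; rewrite ?inE // => /andP[_ /eqP->].
by rewrite mul1r natrX.
Qed.

Lemma sub_cfker_constt_Ind (gT : finGroupType) (G B A : {group gT}) (i : Iirr G) (t : Iirr B) :
    B \subset G -> i \in irr_constt ('Ind[G] 'chi_t) -> G \subset 'N(A)%g ->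
  A \subset cfker 'chi_t -> A \subset cfker 'chi_i.
Proof.
move=> sBG ti nAG kA; apply: subset_trans (cfker_constt (cfInd_char _ (irr_char _)) ti).
by rewrite cfker_Ind_irr // sub_gcore.
Qed.

Variables (gT : finGroupType) (G B : {group gT}).
Hypothesis nsBG : B <| G.

Let sBG := normal_sub nsBG.

Lemma sub_cfker_constt_Res (A : {group gT}) (i : Iirr G) (t : Iirr B) :
    t \in irr_constt ('Res[B] 'chi_i) -> A \subset B -> G \subset 'N(A) ->
  (A \subset cfker 'chi_t) = (A \subset cfker 'chi_i).
Proof.
move=> ti sAB nAG; apply/idP/idP => kA.
  by apply: (sub_cfker_constt_Ind sBG _ nAG) kA; rewrite constt_Ind_Res.
apply: subset_trans (cfker_constt (cfRes_char _ (irr_char _)) ti).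
exact: sub_cfker_Res.
Qed.

Lemma irr1_sum_constt_Res (i : Iirr G) :
  'chi_i 1%g = \sum_t '['Res[B] 'chi_i, 'chi_t] * 'chi_t 1%g.
Proof.
rewrite -(cfRes1 B) {1}(cfun_sum_cfdot ('Res[B] 'chi_i)) sum_cfunE.
by apply: eq_bigr => t _; rewrite cfunE.
Qed.

Lemma cfInd1_sum_constt (t : Iirr B) :
  #|G : B|%:R * 'chi_t 1%g = \sum_i '['Res[B] 'chi_i, 'chi_t] * 'chi[G]_i 1%g.
Proof.
rewrite -cfInd1 // [in LHS](cfun_sum_cfdot ('Ind[G] 'chi_t)) sum_cfunE.
by apply: eq_bigr => i _; rewrite cfunE cfdotC_char ?cfInd_char ?irr_char // -cfdot_Res_l.
Qed.

Lemma sum_square_constt_Res (S : pred (Iirr G)) (Q : pred (Iirr B)) :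
    (forall i t, t \in irr_constt ('Res[B] 'chi_i) -> S i = Q t) ->
  \sum_(i | S i) 'chi_i 1%g ^+ 2 = #|G : B|%:R * \sum_(t | Q t) 'chi_t 1%g ^+ 2.
Proof.
move=> SQ; pose m (i : Iirr G) t := '['Res[B] 'chi_i, 'chi_t].
have mSQ i t : m i t * (S i)%:R = m i t * (Q t)%:R.
  have [ti|] := boolP (t \in irr_constt ('Res[B] 'chi_i)); first by rewrite (SQ i t ti).
  by rewrite irr_consttE negbK /m => /eqP->; rewrite !mul0r.
transitivity (\sum_i \sum_t m i t * 'chi_t 1%g * 'chi_i 1%g * (S i)%:R).
  rewrite big_mkcond; apply: eq_bigr => i _; rewrite -!mulr_suml.
  by rewrite -irr1_sum_constt_Res -expr2 mulr_natr mulrb.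
rewrite exchange_big mulr_sumr [RHS]big_mkcond; apply: eq_bigr => t _.
transitivity ('chi_t 1%g * (\sum_i m i t * 'chi_i 1%g) * (Q t)%:R).
  rewrite mulr_sumr mulr_suml; apply: eq_bigr => i _.
  transitivity (m i t * (S i)%:R * 'chi_t 1%g * 'chi_i 1%g); first by ring.
  by rewrite mSQ; ring.
by rewrite -cfInd1_sum_constt mulrCA -expr2 mulr_natr mulrb.
Qed.

Lemma sum_square_cfker_sub :
  \sum_(i | B \subset cfker 'chi[G]_i) 'chi_i 1%g ^+ 2 = #|G : B|%:R.
Proof.
rewrite -card_quotient ?normal_norm // -irr_sum_square.
transitivity (\sum_(i | B \subset cfker 'chi[G]_i) `|'chi_i 1%g| ^+ 2).
  by apply: eq_bigr => i _; rewrite ger0_norm // ltW ?irr1_gt0.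
rewrite -sum_norm_irr_quo //; apply: eq_bigr => i _.
by rewrite morph1 ger0_norm // ltW ?irr1_gt0.
Qed.

Lemma lin_irr_abelian_quo (i : Iirr G) :
  abelian (G / B) -> B \subset cfker 'chi_i -> 'chi_i \is a linear_char.
Proof.
by move=> abGB; rewrite lin_irr_der1; apply: subset_trans (der1_min (normal_norm nsBG) abGB).
Qed.

Lemma card_irr_abelian_quo :
  abelian (G / B) -> #|[set i | B \subset cfker 'chi[G]_i]| = #|G : B|%g.
Proof.
move=> abGB; apply/eqP; rewrite -(eqr_nat algC) -sum_square_cfker_sub -sum1_card natr_sum.
apply/eqP/eq_big => i; rewrite inE // => /(lin_irr_abelian_quo abGB)/lin_char1->.
by rewrite expr1n.
Qed.

Section AbelianComplementInertia.

Variables (T : {group gT}) (t : Iirr B).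
Hypotheses (lin_t : 'chi_t \is a linear_char) (abT : abelian T).
Hypothesis defI : 'I_G['chi_t] = (B * T)%g.

Lemma inertia_norm_cfker : 'I_G['chi_t] \subset 'N(cfker 'chi_t).
Proof.
apply/subsetP => y /setIP[_ Iy]; rewrite inE -cfker_conjg; last first.
  exact: (subsetP (norm_inertia 'chi_t)).
by rewrite (inertiaJ Iy).
Qed.

Lemma abelian_inertia_quo_cfker : abelian ('I_G['chi_t] / cfker 'chi_t).
Proof.
have nKI := inertia_norm_cfker; have sBI := sub_Inertia 'chi_t sBG.
have sTI : T \subset 'I_G['chi_t] by rewrite defI mulG_subr.
rewrite defI quotientMl ?(subset_trans sBI) // abelianM.
rewrite sub_der1_abelian ?lin_char_der1 //= quotient_abelian //=.
rewrite quotient_cents2 ?(subset_trans sBI) ?(subset_trans sTI) // commGC.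
rewrite gen_subG; apply/subsetP => _ /imset2P[b y Bb Ty ->].
have /setIP[_ Iy] := subsetP sTI y Ty.
have Bby : (b ^ y)%g \in B by rewrite memJ_norm // (subsetP (norm_inertia 'chi_t)).
rewrite /= cfkerEirr inE commgEl lin_charM ?groupV // (inertia_valJ _ Iy).
by rewrite -lin_charM ?groupV // mulVg.
Qed.

(* Modulo [cfker 'chi_t] the inertia group is abelian, so the Clifford
   correspondents of the characters above ['chi_t] are linear. *)
Lemma irr1_abelian_inertia (i : Iirr G) :
  t \in irr_constt ('Res[B] 'chi_i) -> 'chi_i 1%g = #|G : 'I_G['chi_t]|%:R.
Proof.
move=> ti; have [irrI _ bij _ _] := constt_Inertia_bijection t nsBG.
have: i \in irr_constt ('Ind[G] 'chi_t) by rewrite constt_Ind_Res.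
rewrite -bij => /imsetP[s st ->].
rewrite cfIirrE ?irrI // cfInd1 ?Inertia_sub //.
suffices /lin_char1-> : 'chi_s \is a linear_char by rewrite mulr1.
rewrite lin_irr_der1.
apply: subset_trans (der1_min inertia_norm_cfker abelian_inertia_quo_cfker) _.
have sBI : B \subset 'I_G['chi_t]%G := sub_Inertia _ sBG.
exact: (sub_cfker_constt_Ind sBI st inertia_norm_cfker).
Qed.

End AbelianComplementInertia.

Lemma irr1_abelian_sdprod (T : {group gT}) (i : Iirr G) (t : Iirr B) :
    B ><| T = G -> abelian T -> 'chi_t \is a linear_char ->
    t \in irr_constt ('Res[B] 'chi_i) ->
  'chi_i 1%g * #|T :&: 'I['chi_t]|%:R = #|T|%:R.
Proof.
move=> /[dup] defG /sdprodP[_ defBT _ tiBT] abT lin_t ti.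
have sTG : T \subset G by rewrite -defBT mulG_subr.
have defI : 'I_G['chi_t] = (B * (T :&: 'I['chi_t]))%g.
  by rewrite group_modl ?sub_inertia // defBT.
have abTI : abelian (T :&: 'I['chi_t]) := abelianS (subsetIl _ _) abT.
rewrite (irr1_abelian_inertia lin_t abTI defI ti) -natrM; congr _%:R.
have oI : #|'I_G['chi_t]| = (#|B| * #|T :&: 'I['chi_t]|)%N.
  by rewrite defI TI_cardMg // setIA tiBT; apply/setIidPl/sub1G.
apply/eqP; rewrite -(eqn_pmul2l (cardG_gt0 B)) mulnCA -oI mulnC.
by rewrite Lagrange ?Inertia_sub // (sdprod_card defG).
Qed.

End NormalSubgroupCharacters.

Lemma lin_char_eq_gen (gT : finGroupType) (A : {set gT}) (f g : 'CF(<<A>>%G)) :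
    f \is a linear_char -> g \is a linear_char ->
  {in A, f =1 g} -> f = g.
Proof.
move=> linf ling eqfg.
have gS : group_set [set a in <<A>>%G | f a == g a].
  apply/group_setP; split=> [|a b]; first by rewrite inE group1 !lin_char1 /=.
  rewrite !inE => /andP[Ga /eqP fa] /andP[Gb /eqP fb].
  by rewrite groupM // !lin_charM // fa fb /=.
apply/cfunP => a; case Ga: (a \in <<A>>%G); last by rewrite !cfun0 ?Ga.
suffices /subsetP/(_ _ Ga) : <<A>>%G \subset Group gS.
  by rewrite inE Ga => /eqP.
rewrite gen_subG; apply/subsetP => b Ab.
by rewrite inE mem_gen //= eqfg.
Qed.

(** * Additive characters *)

Definition additive_character (U : nmodType) (f : U -> algC) : Prop :=
  (f 0 = 1 /\ forall s t, f (s + t) = f s * f t)%R.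

Section AdditiveCharacters.

Local Open Scope ring_scope.

Lemma sum_additive_character (U : finZmodType) (f : U -> algC) :
  additive_character f -> (exists t, f t != 1) -> \sum_s f s = 0.
Proof.
move=> [_ fD] [t ft]; have: f t * (\sum_s f s) = 1 * (\sum_s f s).
  rewrite mul1r mulr_sumr [RHS](reindex_inj (addrI t)).
  by apply: eq_bigr => s _; rewrite fD.
by move=> e; apply: contraNeq ft => nz; apply/eqP/(mulIf nz).
Qed.

Lemma nontrivial_additive_character (U : finZmodType) :
  (1 < #|U|)%N -> exists2 f : U -> algC, additive_character f & exists t, f t != 1.
Proof.
move=> U_gt1; have nt : [set: U]%G :!=: 1%g by rewrite -cardG_gt1 cardsT.
have [i nz_i] := has_nonprincipal_irr nt.
have lin : 'chi_i \is a linear_char.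
  by apply/char_abelianP; apply/centsP => s _ t _; apply: addrC.
exists ('chi_i : U -> algC); first split.
- exact: lin_char1.
- by move=> s t; have := lin_charM lin (in_setT s) (in_setT t).
apply/existsP; rewrite -negb_forall; apply: contra nz_i => /forallP f1.
rewrite -irr_eq1; apply/eqP/cfunP => t; rewrite cfun1E inE.
exact/eqP.
Qed.

Variables (F : finFieldType) (phi : F -> algC).
Hypothesis phiP : additive_character phi.
Hypothesis phi_nt : exists t, phi t != 1.

Lemma additive_character_scale_nontrivial a : (exists s, phi (a * s) != 1) <-> a != 0.
Proof.
split=> [[s]|na]; first by apply: contraNneq => ->; rewrite mul0r phiP.1.
by have [t nt] := phi_nt; exists (a^-1 * t); rewrite mulVKf.
Qed.

Lemma additive_character_scale_inj a b :
  (forall s, phi (a * s) = phi (b * s)) -> a = b.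
Proof.
move=> ab; apply/eqP; rewrite -subr_eq0.
apply: contraT => /additive_character_scale_nontrivial[s].
by rewrite mulrBl phiP.2 ab -phiP.2 subrr phiP.1 eqxx.
Qed.

(* If [f] differed from every [phi (b * _)], orthogonality would make all the
   sums [\sum_s f s * phi (- (b * s))] vanish, but their sum over [b] is [#|F|]. *)
Lemma additive_character_classification f :
  additive_character f -> exists b, forall s, f s = phi (b * s).
Proof.
move=> [f0 fD]; have [phi0 phiD] := phiP.
pose h b s := f s * phi (- (b * s)).
have hP b : additive_character (h b).
  split=> [|s t]; first by rewrite /h mulr0 oppr0 phi0 f0 mulr1.
  by rewrite /h mulrDr opprD phiD fD; ring.
have [/existsP[b /forallP h1]|none] := boolP [exists b, [forall s, h b s == 1]].
  exists b => s; rewrite -[f s]mulr1 -phi0 -(addNr (b * s)) phiD mulrA.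
  by rewrite -/(h b s) (eqP (h1 s)) mul1r.
have sum_h b : \sum_s h b s = 0.
  apply: sum_additive_character (hP b) _; apply/existsP.
  by rewrite -negb_forall; apply: contraNN none => h1; apply/existsP; exists b.
have: \sum_s \sum_b h b s = 0 by rewrite exchange_big big1.
rewrite (bigD1 0) //= [X in _ + X]big1 => [|s ns].
  rewrite addr0 (eq_bigr (fun=> 1)) => [|b _]; last by rewrite /h mulr0 oppr0 f0 phi0 mulr1.
  rewrite sumr_const => /eqP; rewrite pnatr_eq0 => /eqP cF0.
  by have := finNzRing_gt1 F; rewrite cF0.
rewrite -mulr_sumr sum_additive_character ?mulr0 //.
  by split=> [|a b]; rewrite ?mul0r ?oppr0 // mulrDl opprD phiD.
have [a na] : exists a, phi (- s * a) != 1.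
  by apply/additive_character_scale_nontrivial; rewrite oppr_eq0.
by exists a; rewrite mulrC -mulNr.
Qed.

End AdditiveCharacters.

(** * Groups presented by root subgroups *)

Definition is_root (N j : nat) : bool := 0 < j <= N.

Definition signed_root (gT : finGroupType) (R : nzRingType) (x : nat -> R -> gT)
    (c : option (nat * bool)) (t : R) : gT :=
  if c is Some (k, e) then x k ((-1) ^+ e * t)%R else 1%g.

Definition root_word (gT : finGroupType) (R : Type) (x : nat -> R -> gT)
    (s : seq nat) (a : seq R) : gT :=
  (\prod_(p <- zip s a) x p.1 p.2)%g.

(* [D4_unipotent] for an arbitrary commutator table, given on all ordered pairs. *)
Definition root_presented (N : nat) (comm : nat -> nat -> option (nat * bool))
    (gT : finGroupType) (F : finFieldType) (G : {group gT}) (x : nat -> F -> gT) : Prop :=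
  [/\ forall i t u, is_root N i -> (x i t * x i u)%g = x i (t + u)%R,
      G :=: [set (\prod_(i < N) x i.+1 (d i))%g | d : {ffun 'I_N -> F}],
      injective (fun d : {ffun 'I_N -> F} => \prod_(i < N) x i.+1 (d i))%g
    & forall i j t u, is_root N i -> is_root N j ->
        [~ x i t, x j u]%g = signed_root x (comm i j) (t * u)%R].

Lemma root_word_cat (gT : finGroupType) (R : Type) (x : nat -> R -> gT) s s' (a a' : seq R) :
    size s = size a ->
  root_word x (s ++ s') (a ++ a') = (root_word x s a * root_word x s' a')%g.
Proof. by move=> sz_sa; rewrite /root_word zip_cat // big_cat. Qed.

Section RootTable.

Variable comm : nat -> nat -> option (nat * bool).

Definition comm_in (s s' r : seq nat) : bool :=
  all (fun i => all (fun j => if comm i j is Some (k, _) then k \in r else true) s') s.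

Fixpoint normal_chain (s : seq nat) : bool :=
  if s is j :: s' then comm_in s' [:: j] s' && normal_chain s' else true.

Lemma comm_inP s s' r i j k e :
  comm_in s s' r -> i \in s -> j \in s' -> comm i j = Some (k, e) -> k \in r.
Proof. by move=> /allP c si s'j ij; have := allP (c i si) j s'j; rewrite ij. Qed.

Lemma comm_in_consr s i r s' :
  comm_in s (i :: r) s' = comm_in s [:: i] s' && comm_in s r s'.
Proof. by rewrite /comm_in -all_predI; apply: eq_all => j /=; rewrite andbT. Qed.

Definition normal_roots (N : nat) (s : seq nat) : bool :=
  all (is_root N) s && comm_in s (iota 1 N) s.

Definition coef_conj (R : nzRingType) (i : nat) (t : R) (b : nat -> R) (j : nat) : R :=
  (b j + if comm j i is Some (k, e) then (-1) ^+ e * t * b k else 0)%R.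

Definition coef_conj_word (R : nzRingType) (r : seq nat) (a : seq R) (b : nat -> R) :
    nat -> R :=
  foldr (fun p => coef_conj p.1 p.2) b (zip r a).

End RootTable.

Section RootSubgroups.

Local Open Scope group_scope.
Variables (N : nat) (comm : nat -> nat -> option (nat * bool)).
Variables (gT : finGroupType) (F : finFieldType) (G : {group gT}).
Variable x : nat -> F -> gT.
Hypothesis presG : root_presented N comm G x.
Local Notation q := #|F|.
Local Notation is_root := (is_root N).

Lemma root_eltD i t u : is_root i -> x i t * x i u = x i (t + u)%R.
Proof. by case: presG => xD _ _ _; apply: xD. Qed.

Lemma root_elt0 i : is_root i -> x i 0%R = 1.
Proof. by move=> ri; apply: (mulgI (x i 0%R)); rewrite root_eltD // addr0 mulg1. Qed.

Lemma root_eltC i j t u : is_root i -> is_root j ->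
  [~ x i t, x j u] = signed_root x (comm i j) (t * u)%R.
Proof. by case: presG => _ _ _; apply. Qed.

Lemma root_eltJ i j t u : is_root i -> is_root j ->
  x j u ^ x i t = x j u * signed_root x (comm j i) (u * t)%R.
Proof. by move=> ri rj; rewrite conjg_mulR root_eltC. Qed.

Definition root_gen (s : seq nat) : {group gT} :=
  <<[set g | has (fun j => g \in D4rootX x j) s]>>%G.

Lemma mem_root_gen s j t : j \in s -> x j t \in root_gen s.
Proof.
move=> sj; apply: mem_gen; rewrite inE; apply/hasP; exists j => //.
exact: imset_f.
Qed.

Lemma signed_root_gen s c t :
  (if c is Some (k, _) then k \in s else true) -> signed_root x c t \in root_gen s.
Proof. by case: c => [[k e]|] //= sk; apply: mem_root_gen. Qed.

Lemma root_gen_subP s (H : {group gT}) :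
  reflect (forall j t, j \in s -> x j t \in H) (root_gen s \subset H).
Proof.
apply: (iffP idP) => [/subsetP sH j t sj|xH]; first exact/sH/mem_root_gen.
rewrite gen_subG; apply/subsetP => g; rewrite inE => /hasP[j sj /imsetP[t _ ->]].
exact: xH.
Qed.

Lemma root_gen_sub_all s (H : {group gT}) :
  (root_gen s \subset H) = all (fun j => D4rootX x j \subset H) s.
Proof.
apply/root_gen_subP/allP => [sH j sj|sH j t sj].
  by apply/subsetP => _ /imsetP[t _ ->]; apply: sH.
by apply: (subsetP (sH j sj)); apply: imset_f.
Qed.

Lemma root_gen_subset s s' : {subset s <= s'} -> root_gen s \subset root_gen s'.
Proof. by move=> ss'; apply/root_gen_subP => j t /ss'; apply: mem_root_gen. Qed.

Lemma root_gen_nil : root_gen [::] = 1%G.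
Proof. by apply/trivGP/root_gen_subP. Qed.

Lemma root_gen_norm s s' : all is_root s -> all is_root s' -> comm_in comm s' s s' ->
  root_gen s \subset 'N(root_gen s').
Proof.
move=> /allP rs /allP rs' s'C; apply/root_gen_subP => i t si.
rewrite inE -genJ gen_subG; apply/subsetP => _ /imsetP[g + ->].
rewrite inE => /hasP[j s'j /imsetP[u _ ->]].
rewrite root_eltJ ?(rs i) ?(rs' j) // groupM ?mem_root_gen ?signed_root_gen //.
by case ji: (comm j i) => [[k e]|] //; apply: comm_inP s'C s'j si ji.
Qed.

Lemma root_gen_quo_abelian s s' :
    all is_root s -> all is_root s' -> comm_in comm s' s s' -> comm_in comm s s s' ->
  abelian (root_gen s / root_gen s').
Proof.
move=> /[dup] rss /allP rs rs' s'C sC; have nN := root_gen_norm rss rs' s'C.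
have sA := subset_gen [set g | has (fun j => g \in D4rootX x j) s].
rewrite /= quotient_gen ?(subset_trans sA) // abelian_gen.
rewrite /abelian quotient_cents2 ?(subset_trans sA) // gen_subG.
apply/subsetP => _ /imset2P[g h + + ->]; rewrite !inE.
move=> /hasP[j sj /imsetP[u _ ->]] /hasP[i si /imsetP[t _ ->]].
rewrite root_eltC ?rs // signed_root_gen //.
by case ji: (comm j i) => [[k e]|] //; apply: comm_inP sC sj si ji.
Qed.

Lemma root_gen_abelian s : all is_root s -> comm_in comm s s [::] -> abelian (root_gen s).
Proof.
move=> rs sC; have := root_gen_quo_abelian rs (isT : all is_root [::]) isT sC.
by rewrite root_gen_nil -(isog_abelian (quotient1_isog _)).
Qed.

Lemma mem_root_word s a : root_word x s a \in root_gen s.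
Proof.
rewrite /root_word; elim: s a => [|j s IH] [|t a] /=; rewrite ?big_nil ?group1 //.
have ss : root_gen s \subset root_gen (j :: s).
  by apply: root_gen_subset => k sk; rewrite inE sk orbT.
rewrite big_cons; apply: (groupM (mem_root_gen _ (mem_head _ _))).
exact: (subsetP ss) (IH a).
Qed.

Lemma root_gen_cons j s g : is_root j -> all is_root s -> comm_in comm s [:: j] s ->
  g \in root_gen (j :: s) -> exists t, exists2 h, h \in root_gen s & g = x j t * h.
Proof.
move=> rj rs sC.
have nJ : root_gen [:: j] \subset 'N(root_gen s) by rewrite root_gen_norm //= rj.
have gX : group_set (D4rootX x j).
  apply/group_setP; split=> [|_ _ /imsetP[t _ ->] /imsetP[u _ ->]].
    by apply/imsetP; exists 0%R; rewrite ?root_elt0.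
  by rewrite root_eltD // imset_f.
have eJ : root_gen [:: j] \subset Group gX.
  by apply/root_gen_subP => i t; rewrite inE => /eqP->; apply: imset_f.
have: root_gen (j :: s) \subset root_gen [:: j] <*> root_gen s.
  apply/root_gen_subP => i t; rewrite inE => /orP[/eqP->|si].
    by rewrite mem_gen // inE mem_root_gen ?inE.
  by rewrite mem_gen // inE orbC mem_root_gen.
rewrite norm_joinEl // => /subsetP sub /sub /mulsgP[a h /(subsetP eJ)].
by move=> /imsetP[t _ ->] hs ->; exists t, h.
Qed.

Section NormalChain.

Variable s : seq nat.
Hypotheses (rs : all is_root s) (us : uniq s) (chain_s : normal_chain comm s).

Lemma root_genP g :
  reflect (exists2 a, size a = size s & g = root_word x s a) (g \in root_gen s).
Proof.
apply: (iffP idP) => [|[a _ ->]]; last exact: mem_root_word.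
elim: s rs chain_s g => [_ _ g|j r IH /andP[rj rr] /andP[rC cr] g].
  by rewrite root_gen_nil => /set1P->; exists [::]; rewrite // /root_word big_nil.
case/(root_gen_cons rj rr rC)=> t [h /(IH rr cr)[a sz_a ->] ->].
by exists (t :: a); rewrite /= ?sz_a // /root_word big_cons.
Qed.

Lemma root_word_imset : [set root_word x s a | a : (size s).-tuple F] = root_gen s.
Proof.
apply/setP => g; apply/imsetP/root_genP => [[a _ ->]|[a sz_a ->]].
  by exists a; rewrite ?size_tuple.
by exists (tcast sz_a (in_tuple a)); rewrite // val_tcast.
Qed.

Lemma leq_card_root_gen : q ^ size s <= #|root_gen s|.
Proof.
case: presG => _ _ inj _; pose D := [pred i : 'I_N | i.+1 \in s].
have cD : #|D| = size s.
  rewrite -sum1_card (eq_bigl (fun i : 'I_N => i.+1 \in s)) //.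
  rewrite -(big_mkord (fun i => i.+1 \in s) (fun=> 1%N)).
  rewrite -(big_add1 _ _ 0 N.+1 (fun i => i \in s) (fun=> 1%N)).
  rewrite sum1_count /index_iota -size_filter; apply/perm_size/uniq_perm => //.
    exact/filter_uniq/iota_uniq.
  move=> i; rewrite mem_filter mem_iota andb_idr // => /(allP rs).
  by rewrite /is_root add1n subn1.
rewrite -cD -[q]cardsT -(card_pffun_on 0%R D) -(card_imset _ inj).
apply/subset_leq_card/subsetP => _ /imsetP[d /pffun_onP[dD _] ->].
apply: group_prod => i _; have [si|nsi] := boolP (i.+1 \in s); first exact: mem_root_gen.
by rewrite (supportP dD) ?root_elt0 ?group1 // /is_root ltn_ord.
Qed.

Lemma card_root_gen : #|root_gen s| = (q ^ size s)%N.
Proof.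
apply/eqP; rewrite eqn_leq leq_card_root_gen andbT -root_word_imset.
by rewrite (leq_trans (leq_imset_card _ _)) // card_tuple.
Qed.

Lemma root_word_inj a b : size a = size s -> size b = size s ->
  root_word x s a = root_word x s b -> a = b.
Proof.
move=> sz_a sz_b; have /imset_injP inj :
    #|[set root_word x s a | a : (size s).-tuple F]| == #|{: (size s).-tuple F}|.
  by rewrite root_word_imset card_root_gen card_tuple.
have := inj (tcast sz_a (in_tuple a)) (tcast sz_b (in_tuple b)) isT isT.
by rewrite !val_tcast /= => e /e/(congr1 val); rewrite /= !val_tcast.
Qed.

End NormalChain.

Lemma mem_iota_is_root j : (j \in iota 1 N) = is_root j.
Proof. by rewrite mem_iota add1n. Qed.

Lemma root_gen_all : G = root_gen (iota 1 N).
Proof.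
case: presG => _ defG inj _; apply: group_inj; apply/eqP; rewrite eqEsubset.
apply/andP; split.
  rewrite defG; apply/subsetP => _ /imsetP[d _ ->].
  by apply: group_prod => i _; rewrite mem_root_gen // mem_iota_is_root /is_root ltn_ord.
apply/root_gen_subP => j t; rewrite mem_iota_is_root => /andP[j_gt0 jN].
have jN' : j.-1 < N by rewrite prednK.
rewrite defG; apply/imsetP.
exists [ffun i => if i == Ordinal jN' then t else 0%R] => //.
rewrite (big_only1 (Ordinal jN')) //= => [|i ij _].
  by rewrite ffunE eqxx prednK.
by rewrite ffunE (negPf ij) root_elt0 // /is_root ltn_ord.
Qed.

Lemma card_root_presented : #|G| = (q ^ N)%N.
Proof.
case: presG => _ defG inj _.
by rewrite defG card_imset // card_ffun card_ord.
Qed.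

Lemma root_gen_normal s : normal_roots comm N s -> root_gen s <| G.
Proof.
case/andP=> rs nG; rewrite /normal root_gen_all root_gen_norm ?andbT //; last first.
  by apply/allP => j; rewrite mem_iota_is_root.
by apply: root_gen_subset => j /(allP rs); rewrite mem_iota_is_root.
Qed.

End RootSubgroups.

(** * Coefficients of linear characters on root subgroups *)

Section RootCoefficients.

Local Open Scope ring_scope.
Variables (N : nat) (comm : nat -> nat -> option (nat * bool)).
Variables (gT : finGroupType) (F : finFieldType) (G : {group gT}).
Variable x : nat -> F -> gT.
Hypothesis presG : root_presented N comm G x.
Variable phi : F -> algC.
Hypotheses (phiP : additive_character phi) (phi_nt : exists t, phi t != 1).

Definition root_coef (f : gT -> algC) (j : nat) : F :=
  odflt 0 [pick b | [forall s, f (x j s) == phi (b * s)]].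

Variable s : seq nat.
Hypothesis rs : all (is_root N) s.
Implicit Types f g : 'CF(root_gen x s).

Lemma root_coefE f j t : f \is a linear_char -> j \in s ->
  f (x j t) = phi (root_coef f j * t).
Proof.
move=> linf sj; have rj := allP rs j sj.
rewrite /root_coef; case: pickP => [c /forallP/(_ t)/eqP //|none].
have fP : additive_character (fun t => f (x j t)).
  split=> [|u v]; first by rewrite (root_elt0 presG) // lin_char1.
  by rewrite -(root_eltD presG) // lin_charM ?mem_root_gen.
have [c fc] := additive_character_classification phiP phi_nt fP.
by have /forallP[] := negbT (none c) => u; apply/eqP.
Qed.

Lemma lin_char_root_coef_inj f g : f \is a linear_char -> g \is a linear_char ->
  {in s, root_coef f =1 root_coef g} -> f = g.
Proof.
move=> linf ling fg; apply: lin_char_eq_gen => // a.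
by rewrite inE => /hasP[j sj /imsetP[t _ ->]]; rewrite !root_coefE // fg.
Qed.

Section OneCharacter.

Variable f : 'CF(root_gen x s).
Hypothesis linf : f \is a linear_char.
Local Notation b := (root_coef f).

Lemma root_coef_eq0 j : j \in s -> (b j == 0) = (D4rootX x j \subset cfker f).
Proof.
move=> sj; rewrite cfkerEchar ?lin_charW //.
apply/eqP/subsetP => [b0 _ /imsetP[t _ ->]|kf].
  by rewrite inE mem_root_gen // root_coefE // b0 mul0r lin_char1 // phiP.1 /=.
apply: (additive_character_scale_inj phiP phi_nt) => t; rewrite -root_coefE // mul0r.
have := kf (x j t) (imset_f _ isT); rewrite inE => /andP[_ /eqP->].
by rewrite lin_char1 // phiP.1.
Qed.

(* Conjugation by root elements acts on linear characters through their
   coefficients only, so stabilizers are computed without multiplying in [G]. *)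
Lemma lin_char_root_wordJ r a j t :
    all (is_root N) r -> comm_in comm s r s -> j \in s ->
  f (x j t ^ root_word x r a)%g = phi (coef_conj_word comm r a b j * t).
Proof.
rewrite /root_word /coef_conj_word.
elim: r a j t => [|i r IH] [|u a] j t /=;
  try by rewrite big_nil conjg1 => _ _ /(root_coefE t linf).
move=> /andP[ri rr] /=; rewrite comm_in_consr => /andP[sCi sCr] sj.
have nsW : (\prod_(p <- zip r a) x p.1 p.2)%g \in 'N(root_gen x s)%g.
  exact: (subsetP (root_gen_norm presG rr rs sCr)) _ (mem_root_word _ _ _).
rewrite big_cons conjgM (root_eltJ presG) ?(allP rs j) // conjMg /coef_conj /=.
rewrite lin_charM ?memJ_norm ?mem_root_gen ?IH //; last first.
  apply: signed_root_gen; case ji: (comm j i) => [[k e]|] //.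
  by apply: comm_inP sCi sj (mem_head _ _) ji.
case ji: (comm j i) => [[k e]|] /=; last by rewrite conj1g lin_char1 // mulr1 addr0.
rewrite IH ?(comm_inP sCi sj (mem_head _ _) ji) // -phiP.2; congr (phi _); ring.
Qed.

Section RootWordAction.

Variables (r : seq nat) (a : seq F).
Hypotheses (rr : all (is_root N) r) (sC : comm_in comm s r s).
Local Notation y := (root_word x r a).

Lemma norm_root_word : y \in 'N(root_gen x s)%g.
Proof. exact: (subsetP (root_gen_norm presG rr rs sC)) _ (mem_root_word _ _ _). Qed.

Lemma root_coef_conjg :
  {in s, root_coef (f ^ y^-1)%CF =1 coef_conj_word comm r a b}.
Proof.
move=> j sj; apply: (additive_character_scale_inj phiP phi_nt) => t.
rewrite -(root_coefE t (cfConjg_lin_char _ linf) sj) -(lin_char_root_wordJ a t rr sC sj).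
by rewrite cfConjgE ?groupV ?norm_root_word // invgK.
Qed.

Lemma mem_inertia_root_word :
  (y \in 'I[f]%g) = all (fun j => coef_conj_word comm r a b j == b j) s.
Proof.
rewrite -groupV inE groupV norm_root_word /=; apply/eqP/allP => [fy j sj | fix_b].
  by rewrite -root_coef_conjg // fy.
apply: lin_char_root_coef_inj => // [|j sj]; first exact: cfConjg_lin_char.
by rewrite root_coef_conjg // (eqP (fix_b j sj)).
Qed.

End RootWordAction.

End OneCharacter.

End RootCoefficients.

(** * Linear characters of the abelian section [B / X_12] of the type D4 group *)

Definition D4_table (i j : nat) : option (nat * bool) :=
  if i < j then D4_comm i j
  else if j < i then omap (fun ke => (ke.1, ~~ ke.2)) (D4_comm j i)
  else None.

Lemma D4_comm_root i j k e : D4_comm i j = Some (k, e) -> is_root 12 k.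
Proof.
case: i => [|[|[|[|[|[|[|[|i]]]]]]]] //=;
  by case: j => [|[|[|[|[|[|[|[|[|[|[|[|j]]]]]]]]]]]] //= [<- _].
Qed.

Lemma D4_root_presented (gT : finGroupType) (F : finFieldType) (G : {group gT})
    (x : nat -> F -> gT) :
  D4_unipotent G x -> root_presented 12 D4_table G x.
Proof.
case=> xD defG inj xC; split=> // i j t u.
have x0 k : is_root 12 k -> x k 0%R = 1%g.
  by move=> rk; apply: (mulgI (x k 0%R)); rewrite xD // addr0 mulg1.
have xV k v : is_root 12 k -> (x k v)^-1%g = x k (- v)%R.
  by move=> rk; apply: (mulgI (x k v)); rewrite xD // subrr x0 ?mulgV.
have signedE (c : option (nat * bool)) v :
    signed_root x c v = match c with
      | Some (k, true) => x k (- v)%R | Some (k, false) => x k v | None => 1%g end.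
  by case: c => [[k []]|] //=; rewrite ?expr1 ?mulN1r ?expr0 ?mul1r.
move=> /andP[i0 i12] /andP[j0 j12]; rewrite /D4_table.
case: ltngtP => [ij|ji|<-]; rewrite signedE.
- by rewrite xC.
- rewrite -invg_comm xC // mulrC.
  case E: (D4_comm j i) => [[k []]|] /=; last exact: invg1.
    by rewrite xV ?opprK // (D4_comm_root E).
  by rewrite xV // (D4_comm_root E).
- by apply/eqP/commgP; rewrite /commute !xD ?i0 // addrC.
Qed.

Definition B_roots : seq nat := [:: 3; 5; 6; 7; 8; 9; 10; 11; 12].
Definition T_roots : seq nat := [:: 1; 2; 4].

Section StabilizerEquations.

Local Open Scope ring_scope.
Variable F : finFieldType.
Local Notation F3 := (F * F * F)%type.

Definition dotp (w t : F3) : F := w.1.1 * t.1.1 + w.1.2 * t.1.2 + w.2 * t.2.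

Definition qform (b t : F3) : F :=
  b.1.1 * t.1.1 * t.1.2 + b.1.2 * t.1.1 * t.2 + b.2 * t.1.2 * t.2.

Definition grad_qform (b t : F3) : F3 :=
  (b.1.1 * t.1.2 + b.1.2 * t.2, b.1.1 * t.1.1 + b.2 * t.2, b.1.2 * t.1.1 + b.2 * t.1.2).

Definition coefs : finType := (F * F3 * F3 * F)%type.

(* With [- b 7] in place of [b 7], the condition that root 3 imposes on a
   stabilizing [t] reads [dotp w t + qform b t = 0]. *)
Definition char_coefs (b : nat -> F) : coefs :=
  (b 3, (b 5, b 6, (- b 7)%R), (b 8, b 9, b 10), b 11)%N.

Definition stabilizes (v : coefs) (t : F3) : bool :=
  let: (_, w, b, b11) := v in
  if b11 != 0 then t == 0 else (grad_qform b t == 0) && (dotp w t + qform b t == 0).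

Lemma stabilizesE b t :
  stabilizes (char_coefs b) t =
    all (fun j => coef_conj_word D4_table T_roots [:: t.1.1; t.1.2; t.2] b j == b j) B_roots.
Proof.
case: t => [[t1 t2] t4]; rewrite /stabilizes /coef_conj_word /=.
have fixE (u v c : F) : u - v = c -> (u == v) = (c == 0) by move<-; rewrite subr_eq0.
rewrite /coef_conj /= (fixE _ (b 11) 0) ?(fixE _ (b 12) 0); try ring.
rewrite (fixE _ (b 8) (b 11 * t4)); last by ring.
rewrite (fixE _ (b 9) (b 11 * t2)); last by ring.
rewrite (fixE _ (b 10) (b 11 * t1)); last by ring.
rewrite (fixE _ (b 5) (b 8 * t2 + b 9 * t4 + b 11 * (t2 * t4))); last by ring.
rewrite (fixE _ (b 6) (b 8 * t1 + b 10 * t4 + b 11 * (t1 * t4))); last by ring.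
rewrite (fixE _ (b 7) (- (b 9 * t1 + b 10 * t2 + b 11 * (t1 * t2)))); last by ring.
rewrite (fixE _ (b 3) (- (dotp (b 5, b 6, - b 7) (t1, t2, t4) +
  qform (b 8, b 9, b 10) (t1, t2, t4) + b 11 * (t1 * t2 * t4)))); last first.
  by rewrite /dotp /qform /=; ring.
rewrite !mulf_eq0 !oppr_eq0 eqxx /=; have [->|n11] := eqVneq (b 11) 0.
  rewrite !mul0r !addr0 /= !andbT !xpair_eqE.
  by rewrite [RHS]andbC -!andbA.
rewrite /= !xpair_eqE; apply/idP/idP.
  case/andP=> /andP[/eqP-> /eqP->] /eqP->.
  by rewrite /dotp /qform /= !(mulr0, mul0r, addr0) eqxx.
by case/and5P=> _ _ _ _ /and4P[/eqP-> /eqP-> /eqP-> _]; rewrite !eqxx.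
Qed.

End StabilizerEquations.

Definition stab_order (F : finFieldType) (v : coefs F) : nat := #|[set t | stabilizes v t]|.

Lemma indexg_expn (gT : finGroupType) (G H : {group gT}) q a b :
    (0 < q)%N -> H \subset G -> #|H| = (q ^ a)%N -> #|G| = (q ^ (a + b))%N ->
  #|G : H|%g = (q ^ b)%N.
Proof.
by move=> q_gt0 sHG oH oG; rewrite -divgS // oH oG -expnB ?leq_addr // addKn.
Qed.

Section CharactersTrivialOnX12.

Local Open Scope group_scope.
Local Open Scope ring_scope.
Variables (gT : finGroupType) (F : finFieldType) (G : {group gT}).
Variable x : nat -> F -> gT.
Hypothesis HU : D4_unipotent G x.
Variable phi : F -> algC.
Hypotheses (phiP : additive_character phi) (phi_nt : exists t, phi t != 1).
Local Notation q := #|F|.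
Local Notation B := (root_gen x B_roots).
Local Notation T := (root_gen x T_roots).
Local Notation Z := (root_gen x [:: 12]).
Local Notation v_ f := (char_coefs (root_coef x phi f)).

Let presG := D4_root_presented HU.

Lemma card_field_gt0 : (0 < q)%N.
Proof. exact: ltnW (finNzRing_gt1 F). Qed.

Lemma B_normal : (B <| G)%g.
Proof. exact: (root_gen_normal presG). Qed.

Lemma Z_normal_B : (Z <| B)%g.
Proof.
rewrite /normal (root_gen_norm presG) // andbT root_gen_subset // => j.
by rewrite inE => /eqP->.
Qed.

Lemma card_B : #|B| = (q ^ 9)%N. Proof. exact: (card_root_gen presG). Qed.
Lemma card_T : #|T| = (q ^ 3)%N. Proof. exact: (card_root_gen presG). Qed.
Lemma card_D4 : #|G| = (q ^ 12)%N. Proof. exact: (card_root_presented presG). Qed.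

Lemma abelian_T : abelian T.
Proof. exact: (root_gen_abelian presG). Qed.

Lemma D4_sdprod : (B ><| T = G)%g.
Proof.
have nBT : T \subset 'N(B) by rewrite (root_gen_norm presG).
have defBT : (B * T)%g = G.
  have sTG : T \subset G by rewrite (root_gen_all presG) root_gen_subset //; apply/allP.
  apply/eqP; rewrite eqEsubset mul_subG ?(normal_sub B_normal) //.
  rewrite -norm_joinEr // {1}(root_gen_all presG); apply/root_gen_subP => j t j12.
  have /orP[Bj|Tj] : (j \in B_roots) || (j \in T_roots) by move: j j12; apply/allP.
    by rewrite mem_gen // inE mem_root_gen.
  by rewrite mem_gen // inE orbC mem_root_gen.
rewrite sdprodE //; apply/eqP; rewrite trivg_card1; apply/eqP.
have := mul_cardG B T; rewrite defBT card_B card_T card_D4 -expnD.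
rewrite -[LHS]muln1 => /eqP; rewrite eqn_pmul2l ?expn_gt0 ?card_field_gt0 //.
by move/eqP.
Qed.

Lemma index_B : #|G : B|%g = (q ^ 3)%N.
Proof.
exact: (indexg_expn card_field_gt0 (normal_sub B_normal) card_B card_D4).
Qed.

Lemma irr_B_lin (t : Iirr B) :
  D4rootX x 12 \subset cfker 'chi_t -> 'chi_t \is a linear_char.
Proof.
move=> k12; apply: (lin_irr_abelian_quo Z_normal_B).
  exact: (root_gen_quo_abelian presG).
by rewrite root_gen_sub_all /= k12.
Qed.

Lemma card_inertia_T (f : 'CF(B)) :
  f \is a linear_char -> #|(T :&: 'I[f])%g| = stab_order (v_ f).
Proof.
move=> linf; pose tau (t : F * F * F) := root_word x T_roots [:: t.1.1; t.1.2; t.2].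
have tau_inj : injective tau.
  move=> [[r1 r2] r4] [[t1 t2] t4] /(@root_word_inj _ _ _ _ _ _ presG T_roots).
  by move=> /(_ isT isT isT erefl erefl)[-> -> ->].
rewrite /stab_order -(card_imset _ tau_inj); apply: eq_card => g; rewrite inE.
apply/andP/imsetP => [[/(root_genP presG)[] // a]|[t + ->]].
  case: a => [|t1 [|t2 [|t4 []]]] // _ -> It; exists (t1, t2, t4) => //.
  by rewrite inE stabilizesE -(mem_inertia_root_word presG phiP phi_nt).
rewrite inE stabilizesE -(mem_inertia_root_word presG phiP phi_nt) // => It.
by rewrite mem_root_word.
Qed.

Lemma irr1_mul_stab_order (i : Iirr G) (t : Iirr B) :
    D4rootX x 12 \subset cfker 'chi_t -> t \in irr_constt ('Res[B] 'chi_i) ->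
  'chi_i 1%g * (stab_order (v_ 'chi_t))%:R = (q ^ 3)%:R.
Proof.
move=> /irr_B_lin lin_t ti.
have := irr1_abelian_sdprod B_normal D4_sdprod abelian_T lin_t ti.
by rewrite card_inertia_T // card_T.
Qed.

Lemma root_coef12_eq0 (t : Iirr B) :
  D4rootX x 12 \subset cfker 'chi_t -> root_coef x phi 'chi_t 12%N = 0.
Proof.
by move=> k12; apply/eqP; rewrite (root_coef_eq0 presG phiP phi_nt _ (irr_B_lin k12)).
Qed.

Local Notation trivX12 := [set t : Iirr B | D4rootX x 12 \subset cfker 'chi_t].

Lemma char_coefs_inj : {in trivX12 &, injective (fun t => v_ 'chi_t)}.
Proof.
move=> s t; rewrite !inE => ks kt [e3 e5 e6 /oppr_inj e7 e8 e9 e10 e11].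
apply/irr_inj/(lin_char_root_coef_inj presG phiP phi_nt); rewrite ?irr_B_lin // => j.
by rewrite !inE; do 8?[case/predU1P=> [-> //|]] => /eqP->; rewrite !root_coef12_eq0.
Qed.

Lemma card_trivX12 : #|trivX12| = #|{: coefs F}|.
Proof.
rewrite (eq_card (B := [set t : Iirr B | Z \subset cfker 'chi_t])) => [|t]; last first.
  by rewrite !inE root_gen_sub_all /= andbT.
rewrite (card_irr_abelian_quo Z_normal_B) ?(root_gen_quo_abelian presG) //.
rewrite (indexg_expn card_field_gt0 (normal_sub Z_normal_B) (a := 1) (b := 8)) //.
- by rewrite !card_prod !expnS expn0 muln1 -!mulnA.
- exact: (card_root_gen presG).
- exact: card_B.
Qed.

Lemma card_irr_char_coefs (R : pred (coefs F)) :
  #|[pred t : Iirr B | (D4rootX x 12 \subset cfker 'chi_t) && R (v_ 'chi_t)]| = #|R|.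
Proof.
have onto : [set v_ 'chi_t | t in trivX12] = setT.
  apply/eqP; rewrite eqEcard subsetT cardsT (card_in_imset char_coefs_inj).
  by rewrite card_trivX12 leqnn.
transitivity #|[set t in trivX12 | R (v_ 'chi_t)]|; first by apply: eq_card => t; rewrite !inE.
rewrite -(card_in_imset (f := fun t => v_ 'chi_t)) => [|s t]; last first.
  by rewrite !inE => /andP[ks _] /andP[kt _]; apply: char_coefs_inj; rewrite inE.
apply: eq_card => v; apply/imsetP/idP => [[t + ->]|Rv]; first by rewrite inE => /andP[].
have /imsetP[t kt vE] : v \in [set v_ 'chi_t | t in trivX12] by rewrite onto.
by exists t; rewrite // inE kt -vE.
Qed.

End CharactersTrivialOnX12.

(** * Characters nontrivial on the highest root subgroup *)

Definition A_roots : seq nat := [:: 8; 9; 10; 11; 12].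
Definition S_roots : seq nat := [:: 3; 5; 6; 7].

Lemma coef_conj_S (F : finFieldType) (r3 r5 r6 r7 : F) (b : nat -> F) :
  {in A_roots, coef_conj_word D4_table S_roots [:: r3; r5; r6; r7] b =1
    fun j => (b j + b 12%N * nth 0 [:: - r7; r6; r5; r3] (j - 8)%N)%R}.
Proof.
by move=> j; rewrite !inE; do 4?[case/predU1P=> [->|]]; last move=> /eqP->;
  rewrite /coef_conj_word /coef_conj /=; ring.
Qed.

Section CharactersNontrivialOnX12.

Local Open Scope group_scope.
Local Open Scope ring_scope.
Variables (gT : finGroupType) (F : finFieldType) (G : {group gT}).
Variable x : nat -> F -> gT.
Hypothesis HU : D4_unipotent G x.
Variable phi : F -> algC.
Hypotheses (phiP : additive_character phi) (phi_nt : exists t, phi t != 1).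
Local Notation q := #|F|.
Local Notation A := (root_gen x A_roots).
Local Notation T := (root_gen x T_roots).
Local Notation Z := (root_gen x [:: 12]).
Local Notation coef t := (root_coef x phi 'chi_t).

Let presG := D4_root_presented HU.

Lemma A_normal : (A <| G)%g.
Proof. exact: (root_gen_normal presG). Qed.

Lemma Z_normal : (Z <| G)%g.
Proof. exact: (root_gen_normal presG). Qed.

Lemma irr_A_lin (t : Iirr A) : 'chi_t \is a linear_char.
Proof. by apply/char_abelianP; apply: (root_gen_abelian presG). Qed.

Lemma sub_cfker_X12 (H : {group gT}) (i : Iirr H) :
  (Z \subset cfker 'chi_i) = (D4rootX x 12 \subset cfker 'chi_i).
Proof. by rewrite root_gen_sub_all /= andbT. Qed.

Section InertiaOfNormalizedCharacter.

Variable t : Iirr A.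
Hypothesis coef12 : coef t 12%N != 0.
Hypothesis coef0 : {in [:: 8; 9; 10; 11]%N, coef t =1 fun=> 0}.

Lemma T_sub_inertia : T \subset 'I['chi_t].
Proof.
apply/subsetP => _ /(root_genP presG)[] // a /= sz_a ->.
rewrite (mem_inertia_root_word presG phiP phi_nt (s := A_roots)) ?irr_A_lin //.
case: a sz_a => [|t1 [|t2 [|t4 []]]] //= _.
have c11 : coef t 11%N = 0 by apply: coef0.
by rewrite /coef_conj_word /coef_conj /= c11 !(mulr0, addr0) !eqxx.
Qed.

Lemma S_inertia_eq1 r3 r5 r6 r7 :
    root_word x S_roots [:: r3; r5; r6; r7] \in 'I['chi_t] ->
  root_word x S_roots [:: r3; r5; r6; r7] = 1%g.
Proof.
rewrite (mem_inertia_root_word presG phiP phi_nt (s := A_roots)) ?irr_A_lin // => /allP fix_t.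
have shift0 j : j \in A_roots -> nth 0 [:: - r7; r6; r5; r3] (j - 8) = 0.
  move=> jA; apply/(mulfI coef12)/(addrI (coef t j)).
  by rewrite mulr0 addr0 -coef_conj_S //; apply/eqP/fix_t.
have [r7_0 /= r6_0] := (shift0 8 isT, shift0 9 isT).
have [/= r5_0 /= r3_0] := (shift0 10 isT, shift0 11 isT).
rewrite -[r7]opprK [- r7]r7_0 oppr0 r6_0 r5_0 r3_0.
by rewrite /root_word /= !big_cons big_nil !(root_elt0 presG) // !mulg1.
Qed.

Lemma inertia_AT : 'I_G['chi_t] = (A * T)%g.
Proof.
have sAI : A \subset 'I['chi_t] := sub_inertia _.
have [_ defG _ _] := sdprodP (D4_sdprod HU).
apply/eqP; rewrite eqEsubset; apply/andP; split; last first.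
  rewrite mul_subG // subsetI ?(normal_sub A_normal) ?sub_inertia //.
  by rewrite -{1}defG mulG_subr T_sub_inertia.
apply/subsetP => y /setIP[]; rewrite -{1}defG => /mulsgP[c z Bc Tz ->] Icz.
have Iz := subsetP T_sub_inertia z Tz; rewrite groupMr // in Icz.
apply: mem_mulg Tz; case/(root_genP presG): Bc Icz => // a sz_a ->.
case: a sz_a => [|r3 [|r5 [|r6 [|r7 a]]]] // _.
rewrite -[B_roots]/(S_roots ++ A_roots) -[_ :: _]/([:: r3; r5; r6; r7] ++ a).
rewrite root_word_cat //; have Aa := mem_root_word x A_roots a.
by rewrite (groupMr _ (subsetP sAI _ Aa)) => /S_inertia_eq1->; rewrite mul1g.
Qed.

Lemma index_inertia_X12 : #|G : 'I_G['chi_t]|%g = (q ^ 4)%N.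
Proof.
have oI : #|'I_G['chi_t]| = (q ^ 8)%N.
  rewrite inertia_AT TI_cardMg ?(card_root_gen presG) // -?expnD //.
  have [_ _ _ tiBT] := sdprodP (D4_sdprod HU); apply/trivgP; rewrite -tiBT setSI //.
  by apply: root_gen_subset; apply/allP.
exact: (indexg_expn (card_field_gt0 F) (Inertia_sub G 'chi_t) oI (card_D4 HU)).
Qed.

End InertiaOfNormalizedCharacter.

Section NontrivialX12.

Variable i : Iirr G.
Hypothesis ntX12 : ~~ (D4rootX x 12 \subset cfker 'chi_i).

Lemma coef12_constt_neq0 (t : Iirr A) :
  t \in irr_constt ('Res[A] 'chi_i) -> coef t 12%N != 0.
Proof.
move=> ti; rewrite (root_coef_eq0 presG phiP phi_nt _ (irr_A_lin t)) //.
rewrite -sub_cfker_X12 (sub_cfker_constt_Res A_normal ti) ?(normal_norm Z_normal) //.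
  by rewrite sub_cfker_X12.
by apply: root_gen_subset; apply/allP.
Qed.

(* The conjugates of a constituent on [A] realise all characters of [A] with
   the same restriction to [X_12]; pick the one trivial on [X_8, .., X_11]. *)
Lemma normalized_constt : exists2 t : Iirr A,
  t \in irr_constt ('Res[A] 'chi_i) & {in [:: 8; 9; 10; 11]%N, coef t =1 fun=> 0}.
Proof.
have /neq0_has_constt[t ti] := Res_irr_neq0 A i.
have b12 := coef12_constt_neq0 ti; set b := coef t in b12.
pose r := [:: - b 11%N / b 12%N; - b 10%N / b 12%N; - b 9%N / b 12%N; b 8%N / b 12%N].
pose y := root_word x S_roots r.
have Gy : y \in G.
  apply: subsetP (mem_root_word _ _ _); rewrite (root_gen_all presG).
  by apply: root_gen_subset; apply/allP.
exists (conjg_Iirr t y^-1).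
  by rewrite irr_consttE conjg_IirrE cfdot_Res_conjg ?groupV // -irr_consttE.
move=> j j8; have Aj : j \in A_roots by move: j j8; apply/allP.
rewrite conjg_IirrE (root_coef_conjg presG phiP phi_nt) ?irr_A_lin // coef_conj_S //.
move: j8; rewrite !inE; do 3?[case/predU1P=> [->|]]; last move=> /eqP->.
all: by rewrite /= -/b; field.
Qed.

Lemma irr1_nontrivial_X12 : 'chi_i 1%g = (q ^ 4)%:R.
Proof.
have [t ti coef0] := normalized_constt; have coef12 := coef12_constt_neq0 ti.
have defI := inertia_AT coef12 coef0.
rewrite (irr1_abelian_inertia A_normal (irr_A_lin t) (abelian_T HU) defI ti).
by rewrite index_inertia_X12.
Qed.

End NontrivialX12.

Lemma ndeg_nontrivial_X12 :
  D4ndeg (fun i : Iirr G => ~~ D4inker x 12 i) (q ^ 4) = (q ^ 3 * (q - 1))%N.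
Proof.
have iGZ : #|G : Z|%g = (q ^ 11)%N.
  apply: (indexg_expn (card_field_gt0 F) (normal_sub Z_normal) (a := 1)).
    exact: (card_root_gen presG).
  exact: (card_D4 HU).
have sumX12 : \sum_(i | ~~ (Z \subset cfker 'chi[G]_i)) 'chi_i 1%g ^+ 2 =
    (D4ndeg (fun i : Iirr G => ~~ D4inker x 12 i) (q ^ 4) * q ^ 8)%:R.
  rewrite (expnM q 4 2) -sum_square_ndeg; apply: eq_bigl => i.
  rewrite sub_cfker_X12 /D4inker.
  by have [//|/irr1_nontrivial_X12->] := boolP (_ \subset _); rewrite eqxx.
have := irr_sum_square G; rewrite (bigID (fun i => Z \subset cfker 'chi_i)) /=.
rewrite (sum_square_cfker_sub Z_normal) sumX12 iGZ (card_D4 HU) -natrD.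
move=> /eqP; rewrite eqr_nat.
have -> : (q ^ 12 = q ^ 11 + (q ^ 3 * (q - 1)) * q ^ 8)%N.
  by rewrite mulnAC -expnD mulnBr muln1 -expnSr subnKC ?leq_pexp2l ?card_field_gt0.
by rewrite eqn_add2l eqn_pmul2r ?expn_gt0 ?card_field_gt0 // => /eqP.
Qed.

End CharactersNontrivialOnX12.

(** * Stabilizer orders *)

Lemma card_homogeneous_fiber (U V : finType) (f : U -> V) (y0 : V) :
    (forall y, exists2 h : U -> U, injective h & forall u, (f (h u) == y) = (f u == y0)) ->
  #|[pred u | f u == y0]| * #|V| = #|U|.
Proof.
move=> homog; rewrite -[RHS]sum1_card (partition_big f xpredT) //= mulnC -sum_nat_const.
apply: eq_bigr => y _; have [h h_inj hE] := homog y.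
by rewrite (reindex_inj h_inj) -sum1_card; apply: eq_bigl => u; rewrite inE hE.
Qed.

Lemma odd_card_field (F : finFieldType) : odd #|F| = (2%:R != 0 :> F)%R.
Proof.
apply/idP/idP => [oq|].
  apply: contraTneq oq => F2; rewrite -dvdn2.
  have o1 : #[1%R : F]%g = 2 by apply: nt_prime_order => //; apply: oner_neq0.
  by rewrite -o1 -cardsT order_dvdG // inE.
apply: contraNT; rewrite -dvdn2 -cardsT => d2.
have [y _ oy] := Cauchy (G := [set: F]%G) (isT : prime 2) d2.
have y0 : y != 0%R by apply: contra_eq_neq oy => ->; rewrite order1.
apply/eqP/(mulIf y0); rewrite mul0r mulr_natl.
by have := expg_order y; rewrite oy.
Qed.

Section StabilizerOrders.

Local Open Scope ring_scope.
Variable F : finFieldType.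
Local Notation q := #|F|.
Local Notation F3 := (F * F * F)%type.
Implicit Types (b w d t : F3) (s : F).

Lemma card_F3 : #|{: F3}| = (q ^ 3)%N.
Proof. by rewrite !card_prod !expnS expn0 muln1 mulnA. Qed.

Definition scale3 s d : F3 := (s * d.1.1, s * d.1.2, s * d.2).

Lemma dotp_scale3 w s d : dotp (scale3 s w) d = s * dotp w d.
Proof. by rewrite /dotp /=; ring. Qed.

Lemma dotpC w d : dotp w d = dotp d w.
Proof. by rewrite /dotp; ring. Qed.

Lemma dotp_onto d : d != 0 -> exists w, dotp w d = 1.
Proof.
case: d => [[d1 d2] d3] nz.
have [d10|n1] := eqVneq d1 0; last by exists (d1^-1, 0, 0); rewrite /dotp /=; field.
have [d20|n2] := eqVneq d2 0; last by exists (0, d2^-1, 0); rewrite /dotp /=; field.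
have [d30|n3] := eqVneq d3 0; last by exists (0, 0, d3^-1); rewrite /dotp /=; field.
by move: nz; rewrite d10 d20 d30 eqxx.
Qed.

Lemma scale3_inj d : d != 0 -> injective (scale3 ^~ d).
Proof.
move=> /dotp_onto[w wd] r s /(congr1 (fun t => dotp t w)).
by rewrite !dotp_scale3 dotpC wd !mulr1.
Qed.

Lemma card_dotp_eq0 d : d != 0 -> #|[pred w | dotp w d == 0]| = (q ^ 2)%N.
Proof.
move=> /dotp_onto[w wd].
have dotpD u v : dotp (u + v) d = dotp u d + dotp v d.
  by case: u v => [[u1 u2] u3] [[v1 v2] v3]; rewrite /dotp /=; ring.
have fib := @card_homogeneous_fiber F3 F (fun w => dotp w d) 0.
apply/eqP; rewrite -(eqn_pmul2r (card_field_gt0 F)) fib ?card_F3 -?expnSr // => y.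
exists (+%R^~ (scale3 y w)) => [|u]; first exact: addIr.
by rewrite dotpD dotp_scale3 wd mulr1 -[X in _ == X]add0r (inj_eq (addIr _)).
Qed.

Lemma card_dotp_neq0 d : d != 0 -> #|[pred w | dotp w d != 0]| = (q ^ 2 * (q - 1))%N.
Proof.
move=> nz; have := cardC [pred w | dotp w d == 0].
rewrite card_dotp_eq0 // card_F3 => /(canRL (addKn _)).
by rewrite mulnBr muln1 -expnSr => <-; apply: eq_card.
Qed.

Definition prod3 b : F := b.1.1 * b.1.2 * b.2.

Lemma grad_qform_inj0 b t : 2%:R * prod3 b != 0 -> (grad_qform b t == 0) = (t == 0).
Proof.
case: b t => [[b8 b9] b10] [[t1 t2] t4]; rewrite /prod3 /= !mulf_eq0 !negb_or.
case/andP=> n2 /andP[/andP[n8 n9] n10]; rewrite /grad_qform /=.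
apply/eqP/eqP => [[g1 g2 g4]|[-> -> ->]]; last by rewrite !mulr0 !addr0.
have t40 : t4 = 0.
  apply: (mulfI (mulf_neq0 n2 (mulf_neq0 n9 n10))); rewrite mulr0.
  transitivity (b10 * (b8 * t2 + b9 * t4) + b9 * (b8 * t1 + b10 * t4)
                - b8 * (b9 * t1 + b10 * t2)); first by ring.
  by rewrite g1 g2 g4; ring.
move: g1 g2; rewrite t40 !mulr0 !addr0 => /eqP + /eqP.
by rewrite !mulf_eq0 (negPf n8) /= => /eqP-> /eqP->.
Qed.

Definition grad_kernel b : F3 :=
  if b.1.1 != 0 then (b.2, b.1.2, - b.1.1) else (b.2, - b.1.2, 0).

Lemma grad_kernel_neq0 b : b != 0 -> grad_kernel b != 0.
Proof.
case: b => [[b8 b9] b10]; rewrite /grad_kernel /= !xpair_eqE.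
have [->|n8] := eqVneq b8 0; rewrite /= !xpair_eqE !oppr_eq0 ?(negPf n8) ?andbF //.
by rewrite eqxx andbT andbC.
Qed.

Lemma qform_grad_kernel b : qform b (grad_kernel b) = - prod3 b.
Proof.
rewrite /qform /grad_kernel /prod3.
by have [->|n8] := eqVneq b.1.1 0; rewrite /=; ring.
Qed.

Lemma grad_qform_eq0P b t : b != 0 -> 2%:R * prod3 b = 0 ->
  reflect (exists s, t = scale3 s (grad_kernel b)) (grad_qform b t == 0).
Proof.
case: b t => [[b8 b9] b10] [[t1 t2] t4] nz two.
rewrite /grad_qform /grad_kernel /scale3 /=.
have [b80|n8] := eqVneq b8 0; last first.
  have kernel_eq : b9 * b10 + b10 * b9 = 0.
    by apply: (mulfI n8); rewrite mulr0 -two /prod3 /=; ring.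
  apply: (iffP eqP) => [[g1 g2 _]|[s [-> -> ->]]] /=.
    exists (- t4 / b8); congr (_, _, _); last by field.
      by apply: (mulfI n8); apply/eqP; rewrite -subr_eq0 -g2; apply/eqP; field.
    by apply: (mulfI n8); apply/eqP; rewrite -subr_eq0 -g1; apply/eqP; field.
  congr (_, _, _); try ring.
  by rewrite -(mulr0 s) -kernel_eq; ring.
rewrite b80 in nz *; apply: (iffP eqP) => [[g1 g2 g4]|[s [-> -> ->]]] /=; last first.
  by congr (_, _, _); ring.
have [b90|n9] := eqVneq b9 0; last first.
  exists (- t2 / b9); congr (_, _, _); last first.
  - by apply: (mulfI n9); rewrite !mulr0 -g1 mul0r add0r.
  - by field.
  by apply: (mulfI n9); apply/eqP; rewrite -subr_eq0 -g4; apply/eqP; field.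
have n10 : b10 != 0 by apply: contraNneq nz => ->; rewrite b90.
exists (t1 / b10); rewrite b90 in g4 *; congr (_, _, _); first by field.
  by apply: (mulfI n10); rewrite oppr0 !mulr0 -g4 mul0r add0r.
by apply: (mulfI n10); rewrite !mulr0 -g2 mul0r add0r.
Qed.

Lemma stab_order_b11_neq0 (b3 b11 : F) w b : b11 != 0 -> stab_order (b3, w, b, b11) = 1%N.
Proof.
move=> n11; rewrite -(cards1 (0 : F3)); apply: eq_card => t.
by rewrite !inE /= n11.
Qed.

Lemma stab_order_two_prod3_neq0 (b3 : F) w b :
  2%:R * prod3 b != 0 -> stab_order (b3, w, b, 0) = 1%N.
Proof.
move=> nz; rewrite -(cards1 (0 : F3)); apply: eq_card => t.
rewrite !inE /= eqxx /= grad_qform_inj0 //.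
by case: eqVneq => // ->; rewrite /dotp /qform /= !(mulr0, addr0) eqxx.
Qed.

Lemma stab_order_line (b3 : F) w b : b != 0 -> 2%:R * prod3 b = 0 ->
  stab_order (b3, w, b, 0) = #|[pred s | s * (dotp w (grad_kernel b) - s * prod3 b) == 0]|.
Proof.
move=> nz two; set d := grad_kernel b.
have eqnE s : dotp w (scale3 s d) + qform b (scale3 s d) = s * (dotp w d - s * prod3 b).
  by rewrite -[in RHS]mulrN -qform_grad_kernel /dotp /qform /scale3 /=; ring.
rewrite /stab_order -(card_imset _ (scale3_inj (grad_kernel_neq0 nz))).
apply: eq_card => t; rewrite inE /= eqxx /=; apply/andP/imsetP => [[]|[s + ->]].
  by move=> /(grad_qform_eq0P _ nz two)[s ->] eqn_s; exists s; rewrite // inE -eqnE.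
by rewrite inE -eqnE => eqn_s; split=> //; apply/(grad_qform_eq0P _ nz two); exists s.
Qed.

Lemma stab_order_prod3_eq0 (b3 : F) w b : b != 0 -> prod3 b = 0 ->
  stab_order (b3, w, b, 0) = if dotp w (grad_kernel b) == 0 then q else 1%N.
Proof.
move=> nz p0; rewrite stab_order_line ?p0 ?mulr0 //; case: eqVneq => [->|nd].
  by apply: eq_card => s; rewrite !inE mulr0 subr0 mulr0 eqxx.
rewrite -(card1 (0 : F)); apply: eq_card => s.
by rewrite !inE mulr0 subr0 mulf_eq0 (negPf nd) orbF.
Qed.

Lemma prod3_neq0 b : prod3 b != 0 -> b != 0.
Proof. by apply: contraNneq => ->; rewrite /prod3 mulr0. Qed.

Lemma stab_order_even (b3 : F) w b : 2%:R = 0 :> F -> prod3 b != 0 ->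
  stab_order (b3, w, b, 0) = if dotp w (grad_kernel b) == 0 then 1%N else 2.
Proof.
move=> F2 np; rewrite stab_order_line ?F2 ?mul0r ?prod3_neq0 //.
set c := dotp _ _; have rootE s : (s * (c - s * prod3 b) == 0) = (s \in [set 0; c / prod3 b]).
  by rewrite !inE mulf_eq0 subr_eq0 -[s == c / _](inj_eq (mulIf np)) divfK // [c == _]eq_sym.
rewrite (eq_card (B := [set 0; c / prod3 b])) ?cards2 => [|s]; last by rewrite inE.
by rewrite eq_sym mulf_eq0 invr_eq0 (negPf np) orbF; case: eqVneq.
Qed.

Lemma stab_order_linear_form (b3 : F) w : w != 0 -> stab_order (b3, w, 0, 0) = (q ^ 2)%N.
Proof.
move=> nz; rewrite -(card_dotp_eq0 nz); apply: eq_card => t.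
rewrite !inE /= eqxx /= /grad_qform /qform /= !(mul0r, addr0) eqxx /=.
by rewrite dotpC.
Qed.

Lemma stab_order_trivial (b3 : F) : stab_order (b3, 0, 0, 0) = (q ^ 3)%N.
Proof.
rewrite -card_F3 -cardsT; apply: eq_card => t.
by rewrite !inE /= eqxx /= /grad_qform /qform /dotp /= !(mul0r, addr0) !eqxx.
Qed.

End StabilizerOrders.

(** * Families of characters *)

Definition root_pattern (F : finFieldType) (s s' : seq nat) (j : nat) : pred F :=
  fun a => ((j \in s) ==> (a == 0)%R) && ((j \in s') ==> (a != 0)%R).

Definition triple_pattern (F : finFieldType) (s s' : seq nat) (j k l : nat) :
    pred (F * F * F) :=
  fun w => [&& root_pattern s s' j w.1.1, root_pattern s s' k w.1.2 & root_pattern s s' l w.2].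

Definition coefs_pattern (F : finFieldType) (s s' : seq nat) : pred (coefs F) :=
  fun v => let: (b3, w, b, b11) := v in
    [&& root_pattern s s' 3 b3, triple_pattern s s' 5 6 7 w, triple_pattern s s' 8 9 10 b
      & root_pattern s s' 11 b11].

Lemma card_pair_dep (A B : finType) (P : pred B) (R : B -> pred A) n :
    (forall b, P b -> #|R b| = n) ->
  #|[pred p : A * B | P p.2 && R p.2 p.1]| = #|P| * n.
Proof.
move=> cardR; transitivity (\sum_a \sum_(b | P b && R b a) 1).
  by rewrite pair_big_dep -sum1_card.
rewrite (exchange_big_dep P) /= => [|a b _ /andP[] //].
rewrite -sum_nat_const; apply: eq_big => // b Pb.
by rewrite -(cardR b Pb) -sum1_card; apply: eq_bigl => a; rewrite Pb.
Qed.

(* The conditions on [l :: s] make [X_l] normal modulo the root subgroups in [s],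
   so that its kernel condition can be read off a constituent on [B]. *)
Definition admissible (s s' : seq nat) : bool :=
  [&& uniq s, uniq s', ~~ has [in s'] s, 12 \in s, all [in B_roots] s, all [in B_roots] s',
      normal_roots D4_table 12 s & all (fun l => normal_roots D4_table 12 (l :: s)) s'].

Section Patterns.

Variables (F : finFieldType) (s s' : seq nat).
Hypothesis adm : admissible s s'.
Local Notation q := #|F|.
Local Notation pattern := (@root_pattern F s s').
Local Notation triple := (@triple_pattern F s s').

Let uniq_s : uniq s. Proof. by case/and5P: adm. Qed.
Let uniq_s' : uniq s'. Proof. by case/and5P: adm. Qed.
Let disj : ~~ has [in s'] s. Proof. by case/and5P: adm. Qed.
Let mem12 : 12 \in s. Proof. by case/and5P: adm. Qed.
Let s_sub_B : {subset s <= B_roots}. Proof. by case/and5P: adm => _ _ _ _ /and4P[/allP]. Qed.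
Let s'_sub_B : {subset s' <= B_roots}. Proof. by case/and5P: adm => _ _ _ _ /and4P[_ /allP]. Qed.

Lemma card_triple_pattern j k l :
  #|triple j k l| = \prod_(i <- [:: j; k; l]) #|pattern i|.
Proof.
rewrite !big_cons big_nil muln1 mulnA -!cardX; apply: eq_card => -[[a b] c].
by rewrite !inE -!topredE /= /triple_pattern /= andbA.
Qed.

Lemma card_root_pattern j :
  #|pattern j| = if j \in s then 1 else if j \in s' then q - 1 else q.
Proof.
have memE a : (a \in pattern j) = ((j \in s) ==> (a == 0%R)) && ((j \in s') ==> (a != 0%R)).
  by [].
case: ifPn => [js|njs]; last case: ifPn => [js'|njs'].
- rewrite -(card1 (0%R : F)); apply: eq_card => a.
  by rewrite memE js (negPf (hasPn disj j js)) andbT.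
- by rewrite subn1 -(cardC1 (0%R : F)); apply: eq_card => a; rewrite memE (negPf njs) js'.
- by apply: eq_card => a; rewrite memE (negPf njs) (negPf njs').
Qed.

Lemma prod_card_root_pattern r :
  \prod_(j <- r) #|pattern j| = (q - 1) ^ count [in s'] r * q ^ count [predC [in s ++ s']] r.
Proof.
elim: r => [|j r IH]; first by rewrite big_nil.
rewrite big_cons {}IH card_root_pattern /= mem_cat negb_or.
case: ifPn => [js|_]; last first.
  by case: ifPn => _; rewrite add0n ?add1n expnS; [apply: mulnA | apply: mulnCA].
by rewrite (negPf (hasPn disj j js)) mul1n.
Qed.

Lemma card_coefs_pattern :
  #|@coefs_pattern F s s'| = (q - 1) ^ size s' * q ^ (9 - size (s ++ s')).
Proof.
have u_ss' : uniq (s ++ s') by rewrite cat_uniq uniq_s uniq_s' has_sym disj.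
have ss'B : {subset s ++ s' <= B_roots}.
  by move=> j; rewrite mem_cat => /orP[/s_sub_B|/s'_sub_B].
have countB r : uniq r -> {subset r <= B_roots} -> count [in r] B_roots = size r.
  move=> ur rB; rewrite -size_filter; apply/perm_size/uniq_perm => // [|j].
    exact: filter_uniq.
  by rewrite mem_filter andb_idr // => /rB.
have <- : count [predC [in s ++ s']] B_roots = 9 - size (s ++ s').
  by rewrite -(countB _ u_ss' ss'B) -[9]/(size B_roots) -(count_predC [in s ++ s']) addKn.
rewrite -(countB s') // -prod_card_root_pattern.
have p12 : #|pattern 12| = 1 by rewrite card_root_pattern mem12.
rewrite -[B_roots]/([:: 3] ++ [:: 5; 6; 7] ++ [:: 8; 9; 10] ++ [:: 11; 12]).
rewrite !big_cat /= -!card_triple_pattern.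
rewrite !big_cons big_nil p12 !muln1 !mulnA -!cardX; apply: eq_card => -[[[b3 w] b] b11].
by rewrite !inE -!topredE /= !andbA.
Qed.

Lemma card_triple_8_9_10 :
    perm_eq (s ++ s') (iota 8 5) -> 11 \in s ->
  #|triple 8 9 10| = (q - 1) ^ size s'.
Proof.
move=> ss' s11; rewrite card_triple_pattern prod_card_root_pattern.
have mem_ss' j : j \in iota 8 5 -> j \in s ++ s' by rewrite (perm_mem ss').
have -> : count [predC [in s ++ s']] [:: 8; 9; 10] = 0.
  by rewrite -[RHS](count_pred0 [:: 8; 9; 10]); apply: eq_in_count => j j8;
    rewrite /= mem_ss' //; move: j j8; apply/allP.
rewrite muln1; congr (_ ^ _).
rewrite -size_filter; apply/perm_size/uniq_perm => // [|j]; first exact: filter_uniq.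
rewrite mem_filter andb_idr // => s'j.
have : j \in iota 8 5 by rewrite -(perm_mem ss') mem_cat s'j orbT.
rewrite !inE => /or4P[-> | -> | -> | ]; rewrite ?orbT //.
case/pred2P=> ej; move: s'j; rewrite ej; first by rewrite (negPf (hasPn disj 11 s11)).
by rewrite (negPf (hasPn disj 12 mem12)).
Qed.

Lemma card_coefs_pattern_dep (R : F * F * F -> pred (F * F * F)) n :
    perm_eq (s ++ s') (iota 8 5) -> 11 \in s ->
    (forall b, triple 8 9 10 b -> #|R b| = n) ->
  #|[pred v : coefs F | coefs_pattern s s' v && R v.1.2 v.1.1.2]| = q * (q - 1) ^ size s' * n.
Proof.
move=> ss' s11 cardR; rewrite -(card_triple_8_9_10 ss' s11) -mulnA.
have free j : j \notin iota 8 5 -> pattern j =1 xpredT.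
  by rewrite -(perm_mem ss') mem_cat /root_pattern => /norP[/negPf-> /negPf->].
have p11 : #|pattern 11| = 1 by rewrite card_root_pattern s11.
have p3 : #|pattern 3| = q by apply: eq_card => a; apply: (free 3 isT).
transitivity (#|triple 8 9 10| * (q * n) * #|pattern 11|); last first.
  by rewrite p11 muln1 mulnCA.
rewrite -(card_pair_dep (R := fun b => [pred u : F * (F * F * F) | pattern 3 u.1 & R b u.2])).
  rewrite -cardX; apply: eq_card => -[[[b3 w] b] b11].
  rewrite !inE -!topredE /= /coefs_pattern.
  have -> : triple 5 6 7 w by rewrite /triple_pattern !(free 5, free 6, free 7).
  by rewrite (free 3) //= andbAC.
by move=> b /cardR <-; rewrite -p3 -cardX; apply: eq_card => u; rewrite !inE.
Qed.

Lemma card_coefs_pattern_stab (R : F * F * F -> pred (F * F * F)) d m n :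
    perm_eq (s ++ s') (iota 8 5) -> 11 \in s -> 0 < d -> d * m = q ^ 3 ->
    (forall v : coefs F, coefs_pattern s s' v -> (stab_order v == m) = R v.1.2 v.1.1.2) ->
    (forall b, triple 8 9 10 b -> #|R b| = n) ->
  #|[pred v : coefs F | coefs_pattern s s' v && (d * stab_order v == q ^ 3)]| =
    q * (q - 1) ^ size s' * n.
Proof.
move=> ss' s11 d_gt0 <- stabE cardR; rewrite -(card_coefs_pattern_dep ss' s11 cardR).
apply: eq_card => v; rewrite !inE; have [pv|//] := boolP (coefs_pattern s s' v).
by rewrite eqn_pmul2l // stabE.
Qed.

Lemma triple_pattern_neq0 j k l w : has [in s'] [:: j; k; l] -> triple j k l w -> w != 0%R.
Proof.
move=> has_s'; rewrite /triple_pattern /root_pattern => pw.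
apply: contraTneq has_s' => w0; move: pw; rewrite w0 /= eqxx !implybF.
by case/and3P=> /andP[_ /negPf->] /andP[_ /negPf->] /andP[_ /negPf->].
Qed.

Lemma triple_pattern_eq0 j k l w : all [in s] [:: j; k; l] -> triple j k l w -> w = 0%R.
Proof.
case: w => [[a1 a2] a3]; rewrite /triple_pattern /root_pattern /= andbT.
by case/and3P=> -> -> -> /and3P[/andP[/eqP-> _] /andP[/eqP-> _] /andP[/eqP-> _]].
Qed.

Lemma triple_pattern_prod3_eq0 j k l w :
  has [in s] [:: j; k; l] -> triple j k l w -> prod3 w = 0%R.
Proof.
rewrite /triple_pattern /root_pattern /prod3 /= orbF.
case/or3P=> js /and3P[/andP[p1 _] /andP[p2 _] /andP[p3 _]].
- by move: p1; rewrite js => /eqP->; rewrite !mul0r.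
- by move: p2; rewrite js => /eqP->; rewrite mulr0 mul0r.
- by move: p3; rewrite js => /eqP->; rewrite mulr0.
Qed.

Lemma triple_pattern_prod3_neq0 j k l w :
  all [in s'] [:: j; k; l] -> triple j k l w -> prod3 w != 0%R.
Proof.
rewrite /triple_pattern /root_pattern /prod3 /= andbT => /and3P[js' ks' ls'].
by rewrite js' ks' ls' /= !mulf_eq0 !negb_or => /and3P[/andP[_ ->] /andP[_ ->] /andP[_ ->]].
Qed.

Lemma char_coefs_pattern (b : nat -> F) : b 12 = 0%R ->
  coefs_pattern s s' (char_coefs b) =
    all (fun j => b j == 0%R) s && all (fun j => b j != 0%R) s'.
Proof.
move=> b12.
have allB (r : seq nat) (p : pred nat) : {subset r <= B_roots} ->
    all p r = all (fun j => (j \in r) ==> p j) B_roots.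
  move=> rB; apply/allP/allP => [pr j _|pB j rj]; first exact/implyP/pr.
  by have := pB j (rB j rj); rewrite rj.
have p12 : root_pattern s s' 12 (b 12).
  by rewrite /root_pattern b12 eqxx implybT (negPf (hasPn disj 12 mem12)).
rewrite (allB s) // (allB s') // -all_predI.
transitivity (all (fun j => root_pattern s s' j (b j)) B_roots) => //.
rewrite /= p12 andbT /coefs_pattern /triple_pattern /= -!andbA.
by rewrite oppr_eq0 !andbT.
Qed.

End Patterns.

Definition root_family (gT : finGroupType) (F : finFieldType) (G : {group gT})
    (x : nat -> F -> gT) (s s' : seq nat) : pred (Iirr G) :=
  fun i => all (fun j => D4inker x j i) s && all (fun j => ~~ D4inker x j i) s'.

Definition degree_table (gT : finGroupType) (G : {group gT}) (P : pred (Iirr G))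
    (c : seq (nat * nat)) : Prop :=
  (forall dn, dn \in c -> D4ndeg P dn.1 = dn.2) /\ D4degs_in P (unzip1 c).

Lemma eq_degree_table (gT : finGroupType) (G : {group gT}) (P Q : pred (Iirr G)) c :
  P =1 Q -> degree_table Q c -> degree_table P c.
Proof.
move=> PQ [ndeg degs]; split=> [dn /ndeg <-|i]; last by rewrite PQ; apply: degs.
by apply: eq_card => i; rewrite !inE PQ.
Qed.

Lemma stab_order_gt0 (F : finFieldType) (v : coefs F) : 0 < stab_order v.
Proof.
apply/card_gt0P; exists 0%R; case: v => [[[b3 w] b] b11].
by rewrite inE /stabilizes /grad_qform /dotp /qform /= !(mulr0, addr0) !eqxx if_same.
Qed.

Section FamilyDegrees.

Local Open Scope ring_scope.
Variables (gT : finGroupType) (F : finFieldType) (G : {group gT}).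
Variable x : nat -> F -> gT.
Hypothesis HU : D4_unipotent G x.
Variable phi : F -> algC.
Hypotheses (phiP : additive_character phi) (phi_nt : exists t, phi t != 1).
Local Notation q := #|F|.
Local Notation B := (root_gen x B_roots).
Local Notation v_ f := (char_coefs (root_coef x phi f)).

Let presG := D4_root_presented HU.

Variables s s' : seq nat.
Hypothesis adm : admissible s s'.
Local Notation family := (@root_family gT F G x s s').

Lemma root_family_constt (i : Iirr G) (t : Iirr B) : t \in irr_constt ('Res[B] 'chi_i) ->
  family i = (D4rootX x 12 \subset cfker 'chi_t) && coefs_pattern s s' (v_ 'chi_t).
Proof.
case/and5P: adm => _ _ dis s12 /and4P[/allP sB /allP s'B ns /allP ns'] ti.
have kerE r : normal_roots D4_table 12 r -> {subset r <= B_roots} ->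
    all (fun j => D4inker x j i) r = all (fun j => D4rootX x j \subset cfker 'chi_t) r.
  move=> nr rB; rewrite -!root_gen_sub_all.
  rewrite (sub_cfker_constt_Res (B_normal HU) ti) ?root_gen_subset //.
  exact/normal_norm/(root_gen_normal presG).
rewrite /root_family kerE //; have [k12 | nk12] := boolP (_ \subset _); last first.
  by apply: contraNF nk12 => /andP[/allP/(_ 12 s12)].
have lin_t := irr_B_lin HU k12; have coefE := root_coef_eq0 presG phiP phi_nt _ lin_t.
have b12 := root_coef12_eq0 HU phiP phi_nt k12.
have allE : all (fun j => D4rootX x j \subset cfker 'chi_t) s =
    all (fun j => root_coef x phi 'chi_t j == 0) s.
  by apply: eq_in_all => j /sB Bj; rewrite coefE.
rewrite char_coefs_pattern //= allE; case ks: (all _ s) => //=.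
apply: eq_in_all => l s'l; have Bl := s'B l s'l; rewrite coefE //; congr (~~ _).
have lsB : {subset l :: s <= B_roots} by move=> j; rewrite inE => /predU1P[->|/sB].
by have := kerE (l :: s) (ns' l s'l) lsB; rewrite /= kerE // allE ks !andbT.
Qed.

Lemma root_family_ndeg d : (D4ndeg family d * d ^ 2 =
  #|[pred v : coefs F | coefs_pattern s s' v && (d * stab_order v == q ^ 3)]| * q ^ 3)%N.
Proof.
pose S i := family i && ('chi[G]_i 1%g == d%:R).
pose R (v : coefs F) := coefs_pattern s s' v && (d * stab_order v == q ^ 3)%N.
pose Q (t : Iirr B) := (D4rootX x 12 \subset cfker 'chi_t) && R (v_ 'chi_t).
have SQ i t : t \in irr_constt ('Res[B] 'chi_i) -> S i = Q t.
  move=> ti; rewrite /S /Q /R andbA -(root_family_constt ti); case fi: (family i) => //=.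
  have k12 : D4rootX x 12 \subset cfker 'chi_t.
    by move: fi; rewrite (root_family_constt ti) => /andP[].
  have degE := irr1_mul_stab_order HU phiP phi_nt k12 ti.
  rewrite -(eqr_nat algC) natrM -degE; apply/eqP/eqP => [->//|/mulIf->//].
  by rewrite pnatr_eq0 -lt0n stab_order_gt0.
have := sum_square_constt_Res (B_normal HU) SQ; rewrite (index_B HU).
have -> : \sum_(t | Q t) 'chi_t 1%g ^+ 2 = #|[pred t | Q t]|%:R.
  rewrite -sum1_card natr_sum; apply: eq_bigr => t /andP[/(irr_B_lin HU)/lin_char1-> _].
  by rewrite expr1n.
rewrite sum_square_ndeg (card_irr_char_coefs HU phiP phi_nt R) mulrC -natrM => /eqP.
by rewrite eqr_nat => /eqP.
Qed.

Lemma root_family_degree (i : Iirr G) : family i ->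
  exists2 v : coefs F, coefs_pattern s s' v & 'chi_i 1%g * (stab_order v)%:R = (q ^ 3)%:R.
Proof.
move=> fi; have /neq0_has_constt[t ti] := Res_irr_neq0 B i.
have /andP[k12 v_t] : (D4rootX x 12 \subset cfker 'chi_t) && coefs_pattern s s' (v_ 'chi_t).
  by rewrite -(root_family_constt ti).
by exists (v_ 'chi_t); last exact: irr1_mul_stab_order.
Qed.

End FamilyDegrees.

Lemma root_family_degree_table (gT : finGroupType) (F : finFieldType) (G : {group gT})
    (x : nat -> F -> gT) (s s' : seq nat) (c : seq (nat * nat)) :
    D4_unipotent G x -> admissible s s' ->
    (forall v : coefs F, coefs_pattern s s' v ->
       exists2 d, d \in unzip1 c & d * stab_order v = #|F| ^ 3) ->
    (forall d n, (d, n) \in c -> 0 < d /\ n * d ^ 2 =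
       #|[pred v : coefs F | coefs_pattern s s' v && (d * stab_order v == #|F| ^ 3)]|
         * #|F| ^ 3) ->
  degree_table (@root_family gT F G x s s') c.
Proof.
move=> HU adm degs ndegs.
have [phi phiP phi_nt] := nontrivial_additive_character (finNzRing_gt1 F).
split=> [[d n] /ndegs[d_gt0 ndegE] | i fi].
  apply/eqP; rewrite -(eqn_pmul2r (m := d ^ 2)) ?expn_gt0 ?d_gt0 //=.
  by rewrite (root_family_ndeg HU phiP phi_nt adm) ndegE.
have [v /degs[d cd dE] degE] := root_family_degree HU phiP phi_nt adm fi.
exists d => //; apply/(mulIf (x := (stab_order v)%:R)%R); last by rewrite degE -natrM dE.
by rewrite pnatr_eq0 -lt0n stab_order_gt0.
Qed.

Lemma perm_degree_table (gT : finGroupType) (G : {group gT}) (P : pred (Iirr G)) c c' :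
  perm_eq c c' -> degree_table P c -> degree_table P c'.
Proof.
move=> cc' [ndeg degs]; split=> [dn | i Pi]; first by rewrite -(perm_mem cc'); apply: ndeg.
by have [d cd dE] := degs i Pi; exists d; rewrite // -(perm_mem (perm_map fst cc')).
Qed.

Lemma degree_table_single (gT : finGroupType) (G : {group gT}) (P Q : pred (Iirr G)) d n :
    P =1 Q -> degree_table Q [:: (d, n)] ->
  D4ndeg P d = n /\ D4degs_in P [:: d].
Proof.
by move=> PQ /(eq_degree_table PQ)[ndeg degs]; split=> //; apply: (ndeg (d, n)); rewrite inE.
Qed.

Lemma degree_table_pair (gT : finGroupType) (G : {group gT}) (P Q : pred (Iirr G))
    d0 n0 d1 n1 :
    P =1 Q -> degree_table Q [:: (d0, n0); (d1, n1)] ->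
  [/\ D4ndeg P d0 = n0, D4ndeg P d1 = n1 & D4degs_in P [:: d0; d1]].
Proof.
move=> PQ /(eq_degree_table PQ)[ndeg degs]; split=> //.
  by apply: (ndeg (d0, n0)); rewrite inE eqxx.
by apply: (ndeg (d1, n1)); rewrite !inE eqxx orbT.
Qed.

Lemma setinker_mulg (gT : finGroupType) (G : {group gT}) (A C : {set gT}) (i : Iirr G) :
    1%g \in A -> 1%g \in C ->
  D4setinker (A * C)%g i = D4setinker A i && D4setinker C i.
Proof.
move=> A1 C1; apply/idP/andP => [sAC|[sA sC]]; last exact: mul_subG.
split; apply: subset_trans sAC; first exact: mulg_subl.
exact: mulg_subr.
Qed.

Section FamilyTables.

Variables (gT : finGroupType) (F : finFieldType) (G : {group gT}).
Variable x : nat -> F -> gT.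
Hypothesis HU : D4_unipotent G x.
Local Notation q := #|F|.
Local Notation root_family := (@root_family gT F G x).

Lemma group1_root j : is_root 12 j -> 1%g \in D4rootX x j.
Proof. by move=> rj; rewrite -(root_elt0 (D4_root_presented HU) rj) imset_f. Qed.

Lemma setinker_root_mul j k (i : Iirr G) : is_root 12 j -> is_root 12 k ->
  D4setinker (D4rootX x j * D4rootX x k)%g i = D4inker x j i && D4inker x k i.
Proof. by move=> rj rk; rewrite setinker_mulg ?group1_root. Qed.

Lemma setinker_root_mul3 j k l (i : Iirr G) : is_root 12 j -> is_root 12 k -> is_root 12 l ->
  D4setinker (D4rootX x j * D4rootX x k * D4rootX x l)%g i =
    [&& D4inker x j i, D4inker x k i & D4inker x l i].
Proof.
move=> rj rk rl; rewrite setinker_mulg ?group1_root ?setinker_root_mul ?andbA //.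
by rewrite -[1%g]mulg1 mem_mulg ?group1_root.
Qed.

Let q_gt1 : 1 < q := finNzRing_gt1 F.
Let q_gt0 : 0 < q := card_field_gt0 F.

Let divisor_gt0 d m : d * m = q ^ 3 -> 0 < d.
Proof. by move=> dm; move: (expn_gt0 q 3); rewrite -dm q_gt0 muln_gt0 => /andP[]. Qed.

Lemma degree_table_stab_const s s' d m n : admissible s s' ->
    (forall v : coefs F, coefs_pattern s s' v -> stab_order v = m) -> d * m = q ^ 3 ->
    n * d ^ 2 = (q - 1) ^ size s' * q ^ (9 - size (s ++ s')) * q ^ 3 ->
  degree_table (root_family s s') [:: (d, n)].
Proof.
move=> adm stabE dm ndegE.
apply: (root_family_degree_table HU adm) => [v /stabE->|_ _ /[!inE] /eqP[-> ->]].
  by exists d; rewrite ?inE.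
split; first exact: divisor_gt0 dm.
rewrite ndegE -(card_coefs_pattern F adm); congr (_ * _).
apply: eq_card => v; rewrite !inE -topredE /=.
by have [pv|//] := boolP (coefs_pattern s s' v); rewrite stabE // dm eqxx.
Qed.

Lemma degree_table_stab_dichotomy s s' m0 m1 d0 d1 n0 n1 :
    admissible s s' -> perm_eq (s ++ s') (iota 8 5) -> 11 \in s -> m0 != m1 ->
    (forall (b3 : F) w b, triple_pattern s s' 8 9 10 b -> b != 0%R /\
       stab_order (b3, w, b, 0%R) = if dotp w (grad_kernel b) == 0%R then m0 else m1) ->
    d0 * m0 = q ^ 3 -> d1 * m1 = q ^ 3 ->
    n0 * d0 ^ 2 = (q - 1) ^ size s' * q ^ 6 ->
    n1 * d1 ^ 2 = (q - 1) ^ (size s').+1 * q ^ 6 ->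
  degree_table (root_family s s') [:: (d0, n0); (d1, n1)].
Proof.
move=> adm ss' s11 m01 stab_b dm0 dm1 ndeg0 ndeg1.
have stabE (v : coefs F) : coefs_pattern s s' v ->
    stab_order v = if dotp v.1.1.2 (grad_kernel v.1.2) == 0%R then m0 else m1.
  case: v => [[[b3 w] b] b11] /and4P[_ _ pb].
  by rewrite /root_pattern s11 /= => /andP[/eqP-> _]; apply: (stab_b b3 w b pb).2.
have kernel_neq0 b : triple_pattern s s' 8 9 10 b -> grad_kernel b != 0%R :> F * F * F.
  by case/(stab_b 0%R 0%R)=> /grad_kernel_neq0.
have [d0_gt0 d1_gt0] := (divisor_gt0 dm0, divisor_gt0 dm1).
apply: (root_family_degree_table HU adm) => [v /stabE-> | d n].
  by case: ifP => _; [exists d0 | exists d1]; rewrite ?inE ?eqxx ?orbT.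
rewrite !inE => /orP[] /eqP[-> ->]; split=> //.
- rewrite (card_coefs_pattern_stab adm ss' s11 d0_gt0 dm0
    (R := fun b w => dotp w (grad_kernel b) == 0%R) (n := q ^ 2)) => [|v pv|b pb].
  + by rewrite ndeg0; ring.
  + by rewrite stabE //; case: ifP => _; rewrite ?eqxx // eq_sym (negPf m01).
  + exact: card_dotp_eq0 (kernel_neq0 b pb).
- rewrite (card_coefs_pattern_stab adm ss' s11 d1_gt0 dm1
    (R := fun b w => dotp w (grad_kernel b) != 0%R) (n := q ^ 2 * (q - 1))) => [|v pv|b pb].
  + by rewrite ndeg1 expnS; ring.
  + by rewrite stabE //; case: ifP => _; rewrite ?eqxx // (negPf m01).
  + exact: card_dotp_neq0 (kernel_neq0 b pb).
Qed.

Lemma degree_table_X12 :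
  degree_table (root_family [::] [:: 12]) [:: (q ^ 4, q ^ 3 * (q - 1))].
Proof.
have famE : root_family [::] [:: 12] =1 fun i => ~~ D4inker x 12 i.
  by move=> i; rewrite /D4inker /root_family /= andbT.
have [phi phiP phi_nt] := nontrivial_additive_character (finNzRing_gt1 F).
apply: eq_degree_table famE _; split=> [dn | i ntX12].
  by rewrite inE => /eqP->; apply: (ndeg_nontrivial_X12 HU phiP phi_nt).
by exists (q ^ 4); rewrite ?inE // (irr1_nontrivial_X12 HU phiP phi_nt).
Qed.

Lemma degree_table_X11 :
  degree_table (root_family [:: 12] [:: 11]) [:: (q ^ 3, q ^ 4 * (q - 1))].
Proof.
apply: (degree_table_stab_const (m := 1)) => // [v pv||]; last by rewrite /=; ring.
  by case: v pv => [[[b3 w] b] b11] /and4P[_ _ _ n11]; apply: stab_order_b11_neq0.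
exact: muln1.
Qed.

Lemma degree_table_X8_X9_X10_odd : odd q ->
  degree_table (root_family [:: 11; 12] [:: 8; 9; 10]) [:: (q ^ 3, q * (q - 1) ^ 3)].
Proof.
rewrite odd_card_field => n2.
apply: (degree_table_stab_const (m := 1)) => // [v pv||]; last by rewrite /=; ring.
  case: v pv => [[[b3 w] b] b11] /and4P[_ _ pb /andP[/eqP-> _]].
  by apply: stab_order_two_prod3_neq0; rewrite mulf_neq0 // (triple_pattern_prod3_neq0 _ pb).
exact: muln1.
Qed.

Lemma degree_table_X8_X9_X10_even : ~~ odd q ->
  degree_table (root_family [:: 11; 12] [:: 8; 9; 10])
    [:: (q ^ 3, (q - 1) ^ 3); (q ^ 3 %/ 2, 4 * (q - 1) ^ 4)].
Proof.
move=> even_q; have F2 : (2%:R = 0 :> F)%R.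
  by apply/eqP; rewrite -[_ == _]negbK -odd_card_field.
have half : q ^ 3 %/ 2 * 2 = q ^ 3 by rewrite divnK // dvdn2 oddX.
apply: (@degree_table_stab_dichotomy _ _ 1 2) => //= [b3 w b pb|||].
- have p_neq0 : prod3 b != 0%R by apply: triple_pattern_prod3_neq0 pb.
  by split; [apply: prod3_neq0 | apply: stab_order_even].
- exact: muln1.
- by ring.
- have -> : q ^ 6 = (q ^ 3 %/ 2 * 2) ^ 2 by rewrite half -expnM.
  by ring.
Qed.

Lemma degree_table_X8_X9_X10_mixed s s' :
    admissible s s' -> perm_eq (s ++ s') (iota 8 5) -> 11 \in s ->
    has [in s] [:: 8; 9; 10] -> has [in s'] [:: 8; 9; 10] ->
  degree_table (root_family s s')
    [:: (q ^ 3, (q - 1) ^ (size s').+1); (q ^ 2, q ^ 2 * (q - 1) ^ size s')].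
Proof.
move=> adm ss' s11 has_s has_s'.
apply: (@perm_degree_table _ _ _
  [:: (q ^ 2, q ^ 2 * (q - 1) ^ size s'); (q ^ 3, (q - 1) ^ (size s').+1)]).
  exact: (permEl (perm_catC [:: _] [:: _])).
apply: (@degree_table_stab_dichotomy _ _ q 1) => // [|b3 w b pb||||].
- by rewrite neq_ltn q_gt1 orbT.
- have b_neq0 := triple_pattern_neq0 has_s' pb.
  by split=> //; rewrite stab_order_prod3_eq0 // (triple_pattern_prod3_eq0 has_s pb).
- by rewrite -expnSr.
- exact: muln1.
- by ring.
- by rewrite -expnM.
Qed.

Lemma degree_table_X5_X6_X7 s s' :
    admissible s s' -> perm_eq (s ++ s') (iota 5 8) -> all [in s] (iota 8 4) ->
    has [in s'] [:: 5; 6; 7] ->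
  degree_table (root_family s s') [:: (q, q ^ 2 * (q - 1) ^ size s')].
Proof.
move=> adm ss' s8_11 has_s'.
apply: (degree_table_stab_const adm (m := q ^ 2)) => [v pv||]; last first.
- by rewrite (perm_size ss') /=; ring.
- by rewrite -expnS.
have s8 : all [in s] [:: 8; 9; 10] by case/and5P: s8_11 => /= -> -> ->.
have s11 : 11 \in s by case/and5P: s8_11.
case: v pv => [[[b3 w] b] b11] /and4P[_ pw pb]; rewrite /root_pattern s11 => /andP[/eqP-> _].
rewrite (triple_pattern_eq0 s8 pb) stab_order_linear_form //.
exact: triple_pattern_neq0 has_s' pw.
Qed.

Lemma degree_table_one_trivial_X8_X9_X10 k : k \in [:: 8; 9; 10] ->
  degree_table (root_family [:: k; 11; 12] [seq l <- [:: 8; 9; 10] | l != k])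
    [:: (q ^ 3, (q - 1) ^ 3); (q ^ 2, q ^ 2 * (q - 1) ^ 2)].
Proof. by rewrite !inE => /or3P[] /eqP->; apply: degree_table_X8_X9_X10_mixed. Qed.

Lemma degree_table_one_nontrivial_X8_X9_X10 k : k \in [:: 8; 9; 10] ->
  degree_table (root_family [seq j <- iota 8 5 | j != k] [:: k])
    [:: (q ^ 3, (q - 1) ^ 2); (q ^ 2, q ^ 2 * (q - 1))].
Proof. by rewrite !inE => /or3P[] /eqP->; apply: degree_table_X8_X9_X10_mixed. Qed.

Lemma degree_table_all_nontrivial_X5_X6_X7 :
  degree_table (root_family (iota 8 5) [:: 5; 6; 7]) [:: (q, q ^ 2 * (q - 1) ^ 3)].
Proof. exact: degree_table_X5_X6_X7. Qed.

Lemma degree_table_one_trivial_X5_X6_X7 k : k \in [:: 5; 6; 7] ->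
  degree_table (root_family (k :: iota 8 5) [seq l <- [:: 5; 6; 7] | l != k])
    [:: (q, q ^ 2 * (q - 1) ^ 2)].
Proof. by rewrite !inE => /or3P[] /eqP->; apply: degree_table_X5_X6_X7. Qed.

Lemma degree_table_one_nontrivial_X5_X6_X7 k : k \in [:: 5; 6; 7] ->
  degree_table (root_family [seq j <- iota 5 8 | j != k] [:: k]) [:: (q, q ^ 2 * (q - 1))].
Proof. by rewrite !inE => /or3P[] /eqP->; apply: degree_table_X5_X6_X7. Qed.

Lemma degree_table_linear : degree_table (root_family (iota 5 8) [::]) [:: (1, q ^ 4)].
Proof.
apply: (degree_table_stab_const (m := q ^ 3)) => // [v pv||]; last by rewrite /=; ring.
  case: v pv => [[[b3 w] b] b11] /and4P[_ pw pb /andP[/eqP-> _]].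
  by rewrite (triple_pattern_eq0 _ pw) // (triple_pattern_eq0 _ pb) // stab_order_trivial.
exact: mul1n.
Qed.

End FamilyTables.

Theorem theorem4p1 (gT : finGroupType) (F : finFieldType) (G : {group gT})
  (x : nat -> F -> gT) (HU : D4_unipotent G x) :
  let q := #|F| in
  let X := fun j => D4rootX x j in
  let ink := fun j (i : Iirr G) => D4inker x j i in
  (* 1 *)
      (let P := fun i => ~~ ink 12 i in
       D4ndeg P (q ^ 4) = q ^ 3 * (q - 1) /\ D4degs_in P [:: q ^ 4]) /\
      (* 2 *)
      (let P := fun i => ink 12 i && ~~ ink 11 i in
       D4ndeg P (q ^ 3) = q ^ 4 * (q - 1) /\ D4degs_in P [:: q ^ 3]) /\
      (* 3 *)
      (let P := fun i => D4setinker (X 11 * X 12)%g i &&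
                  [&& ~~ ink 8 i, ~~ ink 9 i & ~~ ink 10 i] in
       if odd q then (D4ndeg P (q ^ 3) = q * (q - 1) ^ 3 /\ D4degs_in P [:: q ^ 3])
       else [/\ D4ndeg P (q ^ 3) = (q - 1) ^ 3,
                D4ndeg P (q ^ 3 %/ 2) = 4 * (q - 1) ^ 4 &
                D4degs_in P [:: q ^ 3; q ^ 3 %/ 2]]) /\
      (* 4 *)
      (forall k, k \in [:: 8; 9; 10] ->
       let P := fun i => D4setinker (X k * X 11 * X 12)%g i &&
                  all (fun l => ~~ ink l i) [seq l <- [:: 8; 9; 10] | l != k] in
       [/\ D4ndeg P (q ^ 3) = (q - 1) ^ 3, D4ndeg P (q ^ 2) = q ^ 2 * (q - 1) ^ 2 &
           D4degs_in P [:: q ^ 3; q ^ 2]]) /\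
      (* 5 *)
      (forall k, k \in [:: 8; 9; 10] ->
       let P := fun i => all (fun j => ink j i) [seq j <- iota 8 5 | j != k] && ~~ ink k i in
       [/\ D4ndeg P (q ^ 3) = (q - 1) ^ 2, D4ndeg P (q ^ 2) = q ^ 2 * (q - 1) &
           D4degs_in P [:: q ^ 3; q ^ 2]]) /\
      (* 6 *)
      (let P := fun i => all (fun j => ink j i) (iota 8 5) &&
                  [&& ~~ ink 5 i, ~~ ink 6 i & ~~ ink 7 i] in
       D4ndeg P q = q ^ 2 * (q - 1) ^ 3 /\ D4degs_in P [:: q]) /\
      (* 7 *)
      (forall k, k \in [:: 5; 6; 7] ->
       let P := fun i => all (fun j => ink j i) (k :: iota 8 5) &&
                  all (fun l => ~~ ink l i) [seq l <- [:: 5; 6; 7] | l != k] in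
       D4ndeg P q = q ^ 2 * (q - 1) ^ 2 /\ D4degs_in P [:: q]) /\
      (* 8 *)
      (forall k, k \in [:: 5; 6; 7] ->
       let P := fun i => all (fun j => ink j i) [seq j <- iota 5 8 | j != k] && ~~ ink k i in
       D4ndeg P q = q ^ 2 * (q - 1) /\ D4degs_in P [:: q]) /\
      (* 9 *)
      (let P := fun i => all (fun j => ink j i) (iota 5 8) in
       D4ndeg P 1 = q ^ 4 /\ D4degs_in P [:: 1]).
Proof.
move=> q X ink.
split; [|split; [|split; [|split; [|split; [|split; [|split; [|split]]]]]]].
- by apply: degree_table_single (degree_table_X12 HU) => i; rewrite /root_family /= andbT.
- by apply: degree_table_single (degree_table_X11 HU) => i; rewrite /root_family /= !andbT.
- have famE i : D4setinker (X 11 * X 12)%g i && [&& ~~ ink 8 i, ~~ ink 9 i & ~~ ink 10 i] =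
      root_family x [:: 11; 12] [:: 8; 9; 10] i.
    by rewrite (setinker_root_mul HU) // /root_family /= !andbT.
  move=> P; case: ifPn => parity.
    exact: degree_table_single famE (degree_table_X8_X9_X10_odd HU parity).
  exact: degree_table_pair famE (degree_table_X8_X9_X10_even HU parity).
- move=> k k8; have rk : is_root 12 k by move: k k8; apply/allP.
  apply: degree_table_pair (degree_table_one_trivial_X8_X9_X10 HU k8) => i.
  by rewrite (setinker_root_mul3 HU) // /root_family [in RHS]/= andbT.
- move=> k k8; apply: degree_table_pair (degree_table_one_nontrivial_X8_X9_X10 HU k8) => i.
  by rewrite /root_family [in RHS]/= andbT.
- apply: degree_table_single (degree_table_all_nontrivial_X5_X6_X7 HU) => i.
  by rewrite /root_family /= !andbT.
- by move=> k k5; apply: degree_table_single (degree_table_one_trivial_X5_X6_X7 HU k5).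
- move=> k k5; apply: degree_table_single (degree_table_one_nontrivial_X5_X6_X7 HU k5) => i.
  by rewrite /root_family [in RHS]/= andbT.
- by apply: degree_table_single (degree_table_linear HU) => i; rewrite /root_family andbT.
Qed.
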